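(* Let $A=R/\mathfrak a$ and $B=S/\mathfrak b$ be standard graded $K$-algebras such that $\mathfrak a_1=\mathfrak b_1=0$, that is, the homogeneous ideals $\mathfrak a\subset R$, $\mathfrak b\subset S$ contain no non-zero linear forms. For any integer $i\ge 1$, there is an isomorphism of graded $K$-vector spaces, given in each degree $j$ by $$[\operatorname{Tor}_i^Q(A\times_K B,K)]_j\cong\begin{cases}0 & \text{if } j\le i,\\ [\operatorname{Tor}_i^Q(A,K)]_{i+1}\oplus[\operatorname{Tor}_i^Q(B,K)]_{i+1}\oplus[\operatorname{Tor}_i^Q(Q/(\mathbf x\cap\mathbf y),K)]_{i+1} & \text{if } j=i+1,\\ [\operatorname{Tor}_i^Q(A,K)]_j\oplus[\operatorname{Tor}_i^Q(B,K)]_j & \text{if } j\ge i+2.\end{cases}$$ In particular, one has $$P^Q_{A\times_K B}(t,s)=\widetilde P^Q_A(t,s)+\widetilde P^Q_B(t,s)+P^Q_{Q/(\mathbf x\cap\mathbf y)}(t,s)$$ and $$\operatorname{reg}(A\times_K B)=\max\{\operatorname{reg}A,\operatorname{reg}B\}.$$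
   Context: $K$ is an arbitrary field; $R=K[x_1,\dots,x_m]$ and $S=K[y_1,\dots,y_n]$ are standard graded polynomial rings with homogeneous maximal ideals $\mathbf x=(x_1,\dots,x_m)$, $\mathbf y=(y_1,\dots,y_n)$, and $Q=R\otimes_K S=K[x_1,\dots,x_m,y_1,\dots,y_n]$. The same symbols $\mathfrak a,\mathfrak b,\mathbf x,\mathbf y$ denote the extended ideals in $Q$. $A$ and $B$ are $Q$-modules via $A\cong Q/(\mathfrak a+\mathbf y)$, $B\cong Q/(\mathbf x+\mathfrak b)$. With canonical projections $\pi_A:A\to K$, $\pi_B:B\to K$, the fiber product is $A\times_K B=\{(a,b)\in A\oplus B\mid \pi_A(a)=\pi_B(b)\}$; it is a cyclic $Q$-module, $A\times_K B\cong Q/(\mathbf x\cap\mathbf y+\mathfrak a+\mathfrak b)$. For a graded $Q$-module $M$, $\beta^Q_{i,j}(M)=\dim_K[\operatorname{Tor}^Q_i(M,K)]_j$, $P^Q_M(t,s)=\sum_{i,j}\beta^Q_{i,j}(M)t^is^j$ is the graded Poincaré series, $\widetilde P^Q_M(t,s)=\sum_{j>i}\beta^Q_{i,j}(M)t^is^j$ is the sum of its terms with $j>i$, and $\operatorname{reg}M=\max\{j-i\mid\beta^Q_{i,j}(M)\ne0\}$ is the Castelnuovo–Mumford regularity.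
   Formalization: The formula reg(A×_K B)=max{reg A, reg B} is stated only if 𝔞≠0, 𝔟≠0, m=0 or n=0, since for 𝔞=𝔟=0 and m,n≥1 it fails: reg A=reg B=0 but A×_K B=Q/(𝐱∩𝐲) has regularity 1, e.g. K[x,y]/(xy). *)

(* Defs.v *)
From HB Require Import structures.
From mathcomp Require Import all_boot all_order all_algebra.
From mathcomp Require Import boolp mpoly.

Set Implicit Arguments.
Unset Strict Implicit.
Unset Printing Implicit Defensive.

Import GRing.Theory.
Local Open Scope ring_scope.
Local Open Scope quotient_scope.

Definition vs_iso (K : fieldType) (V W : lmodType K) : Prop :=
  exists f : {linear V -> W}, bijective f.

Section QuotientSpace.
Variables (K : fieldType) (V : vectType K) (U : {vspace V}).

Definition vquot : Type := Quotient.quot (pred_of_vspace U).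

HB.instance Definition _ := GRing.Zmodule.on vquot.

Definition vquot_pi (v : V) : vquot := \pi_(Quotient.quot (pred_of_vspace U)) v.

Lemma vquot_pi_eq v w : (vquot_pi v == vquot_pi w) = (v - w \in U).
Proof. by rewrite Quotient.idealrBE. Qed.

Lemma vquot_piK (x : vquot) : vquot_pi (repr x) = x.
Proof. exact: reprK. Qed.

Lemma vquot_piB : {morph vquot_pi : v w / v - w}.
Proof. by move=> v w; rewrite /vquot_pi raddfB. Qed.

Definition vquot_scale (c : K) (x : vquot) : vquot := vquot_pi (c *: repr x).

Lemma vquot_piZ c v : vquot_pi (c *: v) = vquot_scale c (vquot_pi v).
Proof.
apply/eqP; rewrite vquot_pi_eq -scalerBr memvZ //.
by rewrite -vquot_pi_eq vquot_piK.
Qed.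

Lemma vquot_piD v w : vquot_pi (v + w) = vquot_pi v + vquot_pi w.
Proof. by rewrite /vquot_pi raddfD. Qed.

Fact vquot_scaleA c d x :
  vquot_scale c (vquot_scale d x) = vquot_scale (c * d) x.
Proof. by rewrite -[x]vquot_piK -!vquot_piZ scalerA. Qed.

Fact vquot_scale1 : left_id 1 vquot_scale.
Proof. by move=> x; rewrite -[x]vquot_piK -!vquot_piZ scale1r. Qed.

Fact vquot_scaleDr : right_distributive vquot_scale +%R.
Proof.
move=> c x y; rewrite -[x]vquot_piK -[y]vquot_piK.
by rewrite -!(vquot_piZ, vquot_piD) scalerDr.
Qed.

Fact vquot_scaleDl x : {morph vquot_scale^~ x : c d / c + d}.
Proof.
by move=> c d; rewrite -[x]vquot_piK -!(vquot_piZ, vquot_piD) scalerDl.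
Qed.

HB.instance Definition _ := GRing.Zmodule_isLmodule.Build K vquot
  vquot_scaleA vquot_scale1 vquot_scaleDr vquot_scaleDl.

Fact vquot_pi_is_linear : linear vquot_pi.
Proof. by move=> c v w; rewrite vquot_piD vquot_piZ. Qed.

HB.instance Definition _ := GRing.isLinear.Build K V vquot *:%R vquot_pi
  vquot_pi_is_linear.

Fact vquot_vect_axiom : Vector.axiom (\dim (U^C)%VS) vquot.
Proof.
pose prj v := vsproj (U^C)%VS (v - projv U v).
have prjE v : vsval (prj v) = v - projv U v by rewrite vsprojK ?memv_projC.
have prj_lin : linear prj.
  move=> c v w; rewrite /prj -linearP; congr vsproj.
  by rewrite linearP scalerBr opprD addrACA.
have prj_eq v w : v - w \in U -> prj v = prj w.
  move=> /projv_id E; rewrite -[v](subrK w) /prj; congr vsproj.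
  by rewrite [projv U _]raddfD /= E opprD addrACA subrr add0r.
pose f (x : vquot) := prj (repr x).
have fE v : f (vquot_pi v) = prj v.
  by apply: prj_eq; rewrite -vquot_pi_eq vquot_piK.
have [r r_lin r_bij] := subvs_vect_iso (U^C)%VS.
exists (r \o f).
  move=> c x y /=; rewrite -[x]vquot_piK -[y]vquot_piK -linearP !fE.
  by rewrite prj_lin r_lin.
have [r' rK r'K] := r_bij.
exists (fun z => vquot_pi (vsval (r' z))) => [x|z] /=.
  rewrite rK prjE -[RHS]vquot_piK; apply/eqP; rewrite vquot_pi_eq.
  by rewrite addrAC subrr sub0r rpredN memv_pi.
rewrite fE -[RHS]r'K; congr r; apply: val_inj; rewrite /= prjE.
have cU : (U^C :&: U = 0)%VS by rewrite capvC capv_compl.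
have := daddv_pi_add (capv_compl U) (w := vsval (r' z)).
rewrite addv_complf memvf (daddv_pi_id cU (subvsP _)) => /(_ isT).
by move=> E; apply/eqP; rewrite subr_eq addrC E.
Qed.

HB.instance Definition _ := Lmodule_hasFinDim.Build K vquot vquot_vect_axiom.

Lemma dim_vquot : \dim {: vquot} = (\dim {: V} - \dim U)%N.
Proof. by rewrite dimvf /dim /= dimv_compl. Qed.

End QuotientSpace.

Section HomogeneousIdeals.
Variables (K : fieldType) (m : nat).
Local Notation R := {mpoly K[m]}.

(* An [idealr] is a proper ideal, so the quotient algebra is nonzero. *)
Record homogIdeal := HomogIdeal {
  hideal :> idealr R;
  hideal_pihomog : forall (d : nat) (p : R),
    p \in (hideal : {pred R}) -> pihomog mdeg d p \in (hideal : {pred R})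
}.

Lemma pihomog0E (p : R) : pihomog mdeg 0 p = (p@_0%MM)%:MP.
Proof.
rewrite pihomogE (eq_bigl (pred1 0%MM)); last by move=> k; rewrite /= mdeg_eq0.
have [p0|p0] := boolP (0%MM \in msupp p).
  rewrite -big_filter filter_pred1_uniq ?msupp_uniq // big_seq1 mpolyX0.
  by rewrite alg_mpolyC.
rewrite big1_seq ?(memN_msupp_eq0 p0) ?mpolyC0 // => k /andP[/eqP-> /=].
by rewrite (negPf p0).
Qed.

(* A proper homogeneous ideal is contained in (x_1, ..., x_m). *)
Lemma hideal_coef0 (a : homogIdeal) p : p \in (a : {pred R}) -> p@_0%MM = 0.
Proof.
move=> /(hideal_pihomog 0); rewrite pihomog0E => h; apply/eqP/negPn/negP => nz.
have := idealMr ((p@_0%MM)^-1)%:MP h.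
by rewrite -mpolyCM mulVf // mpolyC1 idealr1.
Qed.

(* The standard graded algebra R / a. *)
Definition galg (a : homogIdeal) : Type := Quotient.quot (a : idealr R).

HB.instance Definition _ a := GRing.ComNzRing.on (galg a).

Variable a : homogIdeal.

Definition galg_pi (p : R) : galg a := \pi_(Quotient.quot (a : idealr R)) p.

Lemma galg_pi_eq p q : (galg_pi p == galg_pi q) = (p - q \in (a : {pred R})).
Proof. by rewrite Quotient.idealrBE. Qed.

Lemma galg_piK (u : galg a) : galg_pi (repr u) = u.
Proof. exact: reprK. Qed.

Fact galg_pi_zmod : zmod_morphism galg_pi.
Proof. by move=> p q; rewrite /galg_pi raddfB. Qed.
HB.instance Definition _ := GRing.isZmodMorphism.Build R (galg a) galg_pi
  galg_pi_zmod.

Fact galg_pi_monoid : monoid_morphism galg_pi.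
Proof. by split=> [|p q]; rewrite /galg_pi ?rmorph1 ?rmorphM. Qed.
HB.instance Definition _ := GRing.isMonoidMorphism.Build R (galg a) galg_pi
  galg_pi_monoid.

(* The canonical projection R / a -> K. *)
Definition galg_aug (u : galg a) : K := (repr u : R)@_0%MM.

Lemma galg_augE p : galg_aug (galg_pi p) = p@_0%MM.
Proof.
apply/eqP; rewrite -subr_eq0 -mcoeffB; apply/eqP/(@hideal_coef0 a).
by rewrite -galg_pi_eq galg_piK.
Qed.

Fact galg_aug_zmod : zmod_morphism galg_aug.
Proof.
move=> u v; rewrite -[u]galg_piK -[v]galg_piK -raddfB !galg_augE.
exact: mcoeffB.
Qed.
HB.instance Definition _ := GRing.isZmodMorphism.Build (galg a) K galg_aug
  galg_aug_zmod.

Fact galg_aug_monoid : monoid_morphism galg_aug.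
Proof.
split=> [|u v].
  by rewrite -[X in galg_aug X](rmorph1 galg_pi) galg_augE mcoeff1 eqxx.
rewrite -[u]galg_piK -[v]galg_piK -rmorphM !galg_augE; exact: rmorphM.
Qed.
HB.instance Definition _ := GRing.isMonoidMorphism.Build (galg a) K galg_aug
  galg_aug_monoid.

End HomogeneousIdeals.

(* A ring A viewed as a Q-module along phi : Q -> A. *)
Definition algmod (Q A : comNzRingType) (phi : {rmorphism Q -> A}) : Type := A.

Section RestrictionOfScalars.
Variables (Q A : comNzRingType) (phi : {rmorphism Q -> A}).
Local Notation M := (algmod phi).

HB.instance Definition _ := GRing.Zmodule.copy M A.

Definition algmod_scale (q : Q) (u : M) : M := phi q * (u : A).

Fact algmod_scaleA p q u :
  algmod_scale p (algmod_scale q u) = algmod_scale (p * q) u.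
Proof. by rewrite /algmod_scale rmorphM mulrA. Qed.

Fact algmod_scale1 : left_id 1 algmod_scale.
Proof. by move=> u; rewrite /algmod_scale rmorph1 mul1r. Qed.

Fact algmod_scaleDr : right_distributive algmod_scale +%R.
Proof. by move=> q u v; apply: mulrDr. Qed.

Fact algmod_scaleDl u : {morph algmod_scale^~ u : p q / p + q}.
Proof. by move=> p q; rewrite /algmod_scale rmorphD; apply: mulrDl. Qed.

HB.instance Definition _ := GRing.Zmodule_isLmodule.Build Q M
  algmod_scaleA algmod_scale1 algmod_scaleDr algmod_scaleDl.

End RestrictionOfScalars.

Section GradedTor.
Variables (K : fieldType) (n : nat).
Local Notation Q := {mpoly K[n]}.

Definition zhomog (d : int) (p : Q) : Prop :=
  if d is Posz k then p \is k.-homog else p = 0.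

(* A graded free resolution of M by finitely generated free modules.
   gr d v means that v is a homogeneous element of degree d of M. The i-th
   free module is \bigoplus_k Q(- fr_deg i k), with elements written as row
   vectors, and fr_diff i is the map from the (i+1)-st to the i-th one. *)
Record gfree_resolution (M : lmodType Q) (gr : int -> M -> Prop) :=
  GFreeResolution {
  fr_rank : nat -> nat;
  fr_deg : forall i, 'I_(fr_rank i) -> int;
  fr_diff : forall i, 'M[Q]_(fr_rank i.+1, fr_rank i);
  fr_aug : {linear 'rV[Q]_(fr_rank 0) -> M};
  fr_diff_homog : forall i k l,
    zhomog (fr_deg k - fr_deg l) (fr_diff i k l);
  fr_aug_homog : forall k, gr (fr_deg k) (fr_aug (delta_mx 0 k));
  fr_aug_surj : forall v : M, exists u, fr_aug u = v;
  fr_exact0 : forall u,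
    fr_aug u = 0 <-> exists w, u = w *m fr_diff 0;
  fr_exactS : forall i (u : 'rV_(fr_rank i.+1)),
    u *m fr_diff i = 0 <-> exists w, u = w *m fr_diff i.+1
}.

Section Tor.
Variables (M : lmodType Q) (gr : int -> M -> Prop) (F : gfree_resolution gr).

(* F_i (x)_Q K = K^(fr_rank i), since K = Q / (x_1, ..., x_n). *)
Definition tens_diff i : 'Hom('rV[K]_(fr_rank F i.+1), 'rV[K]_(fr_rank F i)) :=
  linfun (mulmxr (map_mx (mcoeff 0%MM) (fr_diff F i))).

Definition tens_deg i (j : int) : {vspace 'rV[K]_(fr_rank F i)} :=
  <<[seq delta_mx 0%R k | k <- enum 'I_(fr_rank F i) & fr_deg k == j]>>%VS.

Definition tor_cycles i j : {vspace 'rV[K]_(fr_rank F i)} :=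
  match i with
  | 0 => tens_deg 0 j
  | i'.+1 => (tens_deg i'.+1 j :&: lker (tens_diff i'))%VS
  end.

Definition tor_bounds i j : {vspace 'rV[K]_(fr_rank F i)} :=
  (tens_diff i @: tens_deg i.+1 j)%VS.

(* [Tor_i^Q(M, K)]_j, computed from the resolution F: cycles modulo boundaries
   in degree j of F (x)_Q K. *)
Definition tor i j : vectType K :=
  vquot (linfun (vsval : subvs_of (tor_cycles i j) -> _)
           @^-1: tor_bounds i j)%VS.

Definition betti i j : nat := \dim {: tor i j}.

(* A formal series \sum_(i, j) c_(i, j) t^i s^j is given by its coefficients. *)
Definition poincare : nat -> int -> nat := fun i j => betti i j.

Definition poincare_above : nat -> int -> nat :=
  fun i j => if (Posz i < j)%R then betti i j else 0%N.

Definition is_reg (r : int) : Prop :=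
  (exists i j, betti i j <> 0%N /\ j - Posz i = r) /\
  (forall i j, betti i j <> 0%N -> (j - Posz i <= r)%R).

End Tor.
End GradedTor.

Lemma comp_mpoly_coef0 (K : fieldType) (n k : nat) (t : n.-tuple {mpoly K[k]}) :
  (forall i, (tnth t i)@_0%MM = 0) ->
  forall q : {mpoly K[n]}, (q \mPo t)@_0%MM = q@_0%MM.
Proof.
move=> t0; elim/mpolyind => [|c d p _ _ IHp]; first by rewrite comp_mpoly0 !mcoeff0.
rewrite comp_mpolyD comp_mpolyZ !mcoeffD !mcoeffZ IHp; congr (_ * _ + _).
rewrite comp_mpolyX rmorph_prod /= mcoeffX.
have [->|/eqP dn0] := eqVneq d 0%MM.
  by rewrite big1 // => i _; rewrite mnm0E expr0 mcoeff1 eqxx.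
have [i di] : exists i, d i != 0%N.
  apply/existsP; apply: contra_notT dn0 => /existsPn h; apply/mnmP => i.
  by rewrite mnm0E; apply/eqP/negPn/h.
by rewrite (bigD1 i) //= rmorphXn /= t0 expr0n (negPf di) mul0r.
Qed.

Section FiberProduct.
Variables (K : fieldType) (m n : nat).
Local Notation R := {mpoly K[m]}.
Local Notation S := {mpoly K[n]}.
Local Notation Q := {mpoly K[m + n]}.

(* Q = R (x)_K S, with x_i = 'X_(lshift n i) and y_i = 'X_(rshift m i). *)
Definition to_R : Q -> R :=
  comp_mpoly [tuple if split i is inl k then 'X_k else 0 | i < m + n].
Definition to_S : Q -> S :=
  comp_mpoly [tuple if split i is inr k then 'X_k else 0 | i < m + n].
HB.instance Definition _ := GRing.RMorphism.on to_R.
HB.instance Definition _ := GRing.RMorphism.on to_S.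

Variables (a : homogIdeal K m) (b : homogIdeal K n).

(* A = R / a = Q / (a + y) and B = S / b = Q / (x + b) as Q-modules. *)
Definition modA : lmodType Q := algmod (galg_pi a \o to_R).
Definition modB : lmodType Q := algmod (galg_pi b \o to_S).

Definition degA (d : int) (u : modA) : Prop :=
  exists2 p : R, zhomog d p & u = galg_pi a p.
Definition degB (d : int) (u : modB) : Prop :=
  exists2 p : S, zhomog d p & u = galg_pi b p.

Definition fprod_pred : {pred (modA * modB)%type} :=
  fun u => galg_aug (u.1 : galg a) == galg_aug (u.2 : galg b).

Lemma to_R0 q : (to_R q)@_0%MM = q@_0%MM.
Proof.
apply: comp_mpoly_coef0 => i; rewrite tnth_mktuple.
by case: (split i) => k; rewrite ?mcoeff0 // mcoeffX mnm1_eq0.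
Qed.

Lemma to_S0 q : (to_S q)@_0%MM = q@_0%MM.
Proof.
apply: comp_mpoly_coef0 => i; rewrite tnth_mktuple.
by case: (split i) => k; rewrite ?mcoeff0 // mcoeffX mnm1_eq0.
Qed.

Fact fprod_closed : submod_closed fprod_pred.
Proof.
split=> [|q [u1 u2] [v1 v2]]; rewrite ![_ \in fprod_pred]/in_mem /= /fprod_pred /=.
  by rewrite !raddf0.
move=> /eqP huv /eqP huv'; rewrite (raddfD (@galg_aug K m a)).
rewrite (raddfD (@galg_aug K n b)) /= huv'; apply/eqP; congr (_ + _).
rewrite [LHS](rmorphM (@galg_aug K m a)) [RHS](rmorphM (@galg_aug K n b)).
congr (_ * _); last exact: huv.
apply: (etrans (galg_augE a (to_R q))); apply: esym.
by apply: (etrans (galg_augE b (to_S q))); rewrite to_R0 to_S0.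
Qed.
HB.instance Definition _ :=
  GRing.isSubmodClosed.Build Q (modA * modB)%type fprod_pred fprod_closed.

(* A x_K B, a Q-submodule of A (+) B. *)
Record fprod := Fprod { fprod_val : modA * modB; _ : fprod_val \in fprod_pred }.

HB.instance Definition _ := [isSub for fprod_val].
HB.instance Definition _ := [Choice of fprod by <:].
HB.instance Definition _ := [SubChoice_isSubLmodule of fprod by <:].

Definition deg_fprod (d : int) (u : fprod) : Prop :=
  degA d (fprod_val u).1 /\ degB d (fprod_val u).2.

End FiberProduct.

Section XcapY.
Variables (K : fieldType) (m n : nat).
Local Notation Q := {mpoly K[m + n]}.

Definition ideal_x : {pred Q} := fun p =>
  `[< exists c : 'I_m -> Q, p = \sum_i c i * 'X_(lshift n i) >].
Definition ideal_y : {pred Q} := fun p =>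
  `[< exists c : 'I_n -> Q, p = \sum_i c i * 'X_(rshift m i) >].

Definition ideal_xy : {pred Q} := [predI ideal_x & ideal_y].

Fact ideal_xy_closed : idealr_closed ideal_xy.
Proof.
have lin k (e : 'I_k -> Q) p u v :
    (exists c : 'I_k -> Q, u = \sum_i c i * e i) ->
    (exists c : 'I_k -> Q, v = \sum_i c i * e i) ->
  exists c : 'I_k -> Q, p * u + v = \sum_i c i * e i.
  move=> [c ->] [d ->]; exists (fun i => p * c i + d i).
  rewrite mulr_sumr -big_split; apply: eq_bigr => i _ /=.
  by rewrite mulrDl mulrA.
split=> [||p u v].
- rewrite inE; apply/andP; split; apply/asboolP; exists (fun=> 0);
    by rewrite big1 // => i _; rewrite mul0r.
- rewrite inE negb_and; apply/orP; left; apply/asboolP => -[c].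
  move/(congr1 (mcoeff 0%MM)); rewrite mcoeff1 eqxx raddf_sum big1 /=.
    by move/eqP; rewrite oner_eq0.
  by move=> i _; rewrite rmorphM /= mcoeffX mnm1_eq0 mulr0.
rewrite !inE => /andP[/asboolP ux /asboolP uy] /andP[/asboolP vx /asboolP vy].
by apply/andP; split; apply/asboolP; apply: lin.
Qed.
HB.instance Definition _ := isIdealr.Build Q ideal_xy ideal_xy_closed.

Definition modXY : lmodType Q :=
  algmod (\pi_(Quotient.quot ideal_xy) : {rmorphism Q -> Quotient.quot ideal_xy}).

Definition degXY (d : int) (u : modXY) : Prop :=
  exists2 q : Q, zhomog d q & u = \pi_(Quotient.quot ideal_xy) q.

End XcapY.

(* Main.v *)
From HB Require Import structures.
From mathcomp Require Import all_boot all_order all_algebra.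
From mathcomp Require Import boolp mpoly.
From mathcomp Require Import zify.
Require Import Defs.

(** Tor is read off the Koszul complex on the variables of [Q] with coefficients
in the module, rather than off a resolution of the module.  If [F] is any graded
free resolution of a cyclic graded module Q / I, dimension shifting along [F]
identifies the homology of F (x) K in homological degree i and internal degree j
with the Koszul homology of Q / I in the same bidegree ([balancing]).  In that
bidegree all the coordinates of a Koszul chain have the same degree w = j - i,
called the weight below; the differential lowers i and raises w by one.

All four modules are cyclic.  Put I = a + (y) and J = b + (x), the kernels of
Q -> A and Q -> B.  Then I + J is the maximal ideal, the kernel of Q -> A x_K B
is the intersection of I and J, and Q / (x \cap y) is the case a = b = 0.  The
exact sequence
  0 -> Q / (I \cap J) -> Q / I (+) Q / J -> K -> 0
and the fact that the Koszul homology of K is concentrated in weight 0 give the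
three cases of the theorem.
 - In weight w >= 2 both neighbouring terms coming from K vanish and the middle
   map is an isomorphism on homology ([HAB_high]).
 - In weight w = 1 the middle map is still onto ([HAB_both_prod]).  Its kernel
   is the cokernel of the map from the weight 0 homology of Q / I and Q / J
   to that of K ([both_subquo_E]).  Weight 0 homology only sees the linear
   forms of the ideals, hence it does not change if a and b are replaced by 0
   ([conn_subquo_IA]).  For a = b = 0 the kernel is the whole homology of
   Q / (x \cap y) in weight 1, because Q / (x) and Q / (y) have linear
   resolutions ([kos_linear]).
 - In weight w <= 0 a cycle modulo I \cap J is a true cycle, since the
   intersection contains no linear form; and the Koszul complex of [Q] is exact
   in positive homological degree ([HAB_low]).

The Poincare series is the sum of these statements.  For the regularity, the
Koszul complex has no chains above degree m + n and the free modules of [F]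
have finite rank, so that the regularity of A and of B exists ([reg_exists]).
The strand of Q / (x \cap y) has weight 1, and it is dominated as soon as
a or b is nonzero, for then a minimal generator of degree d >= 2 contributes to
Tor_1 in weight d - 1 >= 1 ([generator_degree]); it is absent if m = 0 or n = 0
([xy_mn0]). *)

Set Implicit Arguments.
Unset Strict Implicit.
Unset Printing Implicit Defensive.

Import Order.TTheory GRing.Theory Num.Theory.
Local Open Scope ring_scope.

(** * Additive subgroups and pointed choice *)

Definition zsub (M : zmodType) (N : M -> Prop) : Prop :=
  N 0 /\ forall u v, N u -> N v -> N (u - v).

Section Subgrp.
Variables (M : zmodType) (N : M -> Prop).
Hypothesis hN : zsub N.

Lemma zsub0 : N 0. Proof. by case: hN. Qed.
Lemma zsubB u v : N u -> N v -> N (u - v).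
Proof. by case: hN => _; apply. Qed.
Lemma zsubN u : N u -> N (- u).
Proof. by move=> Nu; rewrite -sub0r; apply: zsubB => //; apply: zsub0. Qed.
Lemma zsubD u v : N u -> N v -> N (u + v).
Proof. by move=> Nu Nv; rewrite -[v]opprK; apply/zsubB/zsubN. Qed.
Lemma zsub_sum I (r : seq I) (P : pred I) (f : I -> M) :
  (forall i, P i -> N (f i)) -> N (\sum_(i <- r | P i) f i).
Proof. by move=> h; elim/big_ind: _ => //; [apply: zsub0|apply: zsubD]. Qed.
End Subgrp.

(** Coordinatewise liftings of Koszul chains must send 0 to 0, otherwise they
do not preserve the homological degree. *)
Lemma pointed_choice (X Y : zmodType) (P : X -> Prop) (R : X -> Y -> Prop) :
  (forall z, P z -> exists y, R z y) -> R 0 0 ->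
  exists2 g : X -> Y, g 0 = 0 & forall z, P z -> R z (g z).
Proof.
move=> h R0; have [z|g hg] := @choice _ _ (fun z y => P z -> R z y).
  by case: (pselect (P z)) => [/h[y ?]|?]; [exists y|exists 0].
exists (fun z => if z == 0 then 0 else g z); first by rewrite eqxx.
by move=> z Pz; case: eqP => [->|_] //; apply: hg.
Qed.

(** * Koszul complexes as iterated mapping cones *)

Section KoszulDef.
Variables (Q : comNzRingType) (M : lmodType Q).

(** The Koszul complex on [x :: l] is the mapping cone of the multiplication by [x]
on the complex on [l]; the total space of the complex on a list of length k is
thus a 2^k-fold power of [M], and the sign rule is the one of a cone. *)
Fixpoint koszul (l : seq Q) : lmodType Q :=
  if l is _ :: l' then (koszul l' * koszul l')%type else M.

Fixpoint kdiff (l : seq Q) : koszul l -> koszul l :=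
  match l with
  | [::] => fun _ => 0
  | x :: l' => fun u => (kdiff u.1 + x *: u.2, - kdiff u.2)
  end.

(** In the cone, the second component of a chain of degree i has degree i - 1. *)
Fixpoint kdeg (l : seq Q) : nat -> koszul l -> Prop :=
  match l with
  | [::] => fun i u => if i is 0%N then True else u = 0
  | x :: l' => fun i u => kdeg i u.1 /\ if i is i'.+1 then kdeg i' u.2 else u.2 = 0
  end.

(** The subcomplex attached to a submodule, and the chains of a given weight, are
both described by a condition on coordinates. *)
Fixpoint kall (N : M -> Prop) (l : seq Q) : koszul l -> Prop :=
  match l with
  | [::] => N
  | x :: l' => fun u => kall N u.1 /\ kall N u.2
  end.

(** The chains of homological degree 0 are the images of [kin], see [kinP]. *)
Fixpoint kin (l : seq Q) (z : M) : koszul l :=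
  match l with
  | [::] => z
  | x :: l' => (kin l' z, 0)
  end.

End KoszulDef.

(** Serves for linear maps as well as for coordinatewise choices of preimages. *)
Fixpoint kmap (Q : comNzRingType) (M M' : lmodType Q) (g : M -> M') (l : seq Q) :
    koszul M l -> koszul M' l :=
  match l with
  | [::] => g
  | x :: l' => fun u => (kmap g u.1, kmap g u.2)
  end.

Section Koszul.
Variables (Q : comNzRingType) (M : lmodType Q).
Implicit Types (l : seq Q) (N : M -> Prop) (c : Q).

Lemma kdiff_lin l c (u v : koszul M l) : kdiff (c *: u + v) = c *: kdiff u + kdiff v.
Proof.
elim: l u v => [|x l IH] u v /=; first by rewrite scaler0 addr0.
apply: injective_projections; rewrite /= !IH.
  by rewrite !scalerDr !scalerA addrACA [x * c]mulrC.
by rewrite opprD -scalerN.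
Qed.

Lemma kdiffD l : {morph @kdiff Q M l : u v / u + v}.
Proof. by move=> u v; have := kdiff_lin 1 u v; rewrite !scale1r. Qed.
Lemma kdiff0 l : kdiff (0 : koszul M l) = 0.
Proof. by apply: (addrI (kdiff 0)); rewrite -kdiffD !addr0. Qed.
Lemma kdiffN l : {morph @kdiff Q M l : u / - u}.
Proof. by move=> u; apply: (addrI (kdiff u)); rewrite -kdiffD !subrr kdiff0. Qed.
Lemma kdiffB l : {morph @kdiff Q M l : u v / u - v}.
Proof. by move=> u v; rewrite kdiffD kdiffN. Qed.
Lemma kdiffZ l c : {morph @kdiff Q M l : u / c *: u}.
Proof. by move=> u; have := kdiff_lin c u 0; rewrite kdiff0 !addr0. Qed.

Lemma kdiffK l (u : koszul M l) : kdiff (kdiff u) = 0.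
Proof.
elim: l u => [|x l IH] u //=.
apply: injective_projections; rewrite /=; last by rewrite kdiffN opprK IH.
by rewrite kdiffD kdiffZ IH add0r scalerN subrr.
Qed.

Lemma kdeg_lin l i c (u v : koszul M l) : kdeg i u -> kdeg i v -> kdeg i (c *: u + v).
Proof.
elim: l i u v => [|x l IH] [|i] u v //=.
- by move=> -> ->; rewrite scaler0 addr0.
- move=> [hu u0] [hv v0]; split; first exact: IH.
  by rewrite [(u : _ * _).2]u0 [(v : _ * _).2]v0 /= scaler0 addr0.
by move=> [hu u0] [hv v0]; split; apply: IH.
Qed.

Lemma kdeg0 l i : kdeg i (0 : koszul M l).
Proof. by elim: l i => [|x l IH] [|i] //=; split. Qed.

Lemma kdeg_zsub l i : zsub (@kdeg Q M l i).
Proof.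
split=> [|u v hu hv]; first exact: kdeg0.
by rewrite addrC -scaleN1r; apply: kdeg_lin.
Qed.

Lemma kdegZ l i c (u : koszul M l) : kdeg i u -> kdeg i (c *: u).
Proof. by move=> hu; rewrite -[_ *: _]addr0; apply/kdeg_lin/kdeg0. Qed.

Lemma kdeg_kdiff0 l (u : koszul M l) : kdeg 0 u -> kdiff u = 0.
Proof.
elim: l u => [|x l IH] u //= [/IH-> u0].
by rewrite [(u : _ * _).2]u0 /= scaler0 kdiff0 oppr0 addr0.
Qed.

Lemma kdeg_kdiff l i (u : koszul M l) : kdeg i.+1 u -> kdeg i (kdiff u).
Proof.
elim: l i u => [|x l IH] i u /=; first by case: i.
move=> [h1 h2]; split.
  by apply: (zsubD (@kdeg_zsub l i)); [apply: IH|apply: kdegZ].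
case: i h1 h2 => [|i] h1 h2; first by rewrite kdeg_kdiff0 ?oppr0.
by apply: (zsubN (@kdeg_zsub l i)); apply: IH.
Qed.

Lemma kdeg_big l i (u : koszul M l) : (size l < i)%N -> kdeg i u -> u = 0.
Proof.
elim: l i u => [|x l IH] [|i] //= [u v] /= si [hu hv].
by congr (_, _); apply: (IH i.+1 u _ hu) || apply: (IH i v _ hv); lia.
Qed.

Lemma kall_lin N l c (u v : koszul M l) :
  (forall u v, N u -> N v -> N (c *: u + v)) ->
  kall N u -> kall N v -> kall N (c *: u + v).
Proof.
move=> hN; elim: l u v => [|x l IH] u v //=; first exact: hN.
by move=> [u1 u2] [v1 v2]; split; apply: IH.
Qed.

Lemma kall_zsub N l : zsub N -> zsub (@kall Q M N l).
Proof.
move=> hN; split; first by elim: l => [|x l IH] //=; apply: zsub0.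
elim: l => [|x l IH] u v //=; first exact: zsubB.
by move=> [u1 u2] [v1 v2]; split; apply: IH.
Qed.

Lemma kallW N N' l (u : koszul M l) :
  (forall z, N z -> N' z) -> kall N u -> kall N' u.
Proof.
by move=> h; elim: l u => [|x l IH] u //=; [apply: h|case=> ? ?; split; apply: IH].
Qed.

Lemma kall_and N N' l (u : koszul M l) :
  kall (fun z => N z /\ N' z) u <-> kall N u /\ kall N' u.
Proof.
elim: l u => [|x l IH] u //=; rewrite !IH.
by split=> [[[? ?] [? ?]]|[[? ?] [? ?]]].
Qed.

Lemma kallT N l (u : koszul M l) : (forall z, N z) -> kall N u.
Proof. by move=> h; elim: l u => [|x l IH] u /=. Qed.

Lemma kall_kmap N (M' : lmodType Q) (g : M' -> M) l (u : koszul M' l) :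
  kall N (kmap g u) <-> kall (fun z => N (g z)) u.
Proof. by elim: l u => [|x l IH] u //=; rewrite !IH. Qed.

Lemma kallZ N l c (u : koszul M l) : kall N (c *: u) <-> kall (fun z => N (c *: z)) u.
Proof. by elim: l u => [|x l IH] u //=; rewrite !IH. Qed.

(** Used with [g] a choice of approximations, and [N'] what the error satisfies. *)
Lemma kallBf N N' (g : M -> M) l c (u : koszul M l) :
  (forall z, N z -> N' (z - c *: g z)) -> kall N u -> kall N' (u - c *: kmap g u).
Proof.
move=> h; elim: l u => [|x l IH] u /=; first exact: h.
by move=> [? ?]; split; apply: IH.
Qed.

Lemma kall0 l (u : koszul M l) : kall (fun z => z = 0) u <-> u = 0.
Proof.
elim: l u => [|x l IH] u //=; rewrite !IH.
by split=> [[]|->] //; case: u => u v /= -> ->.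
Qed.

(** Each coordinate of the boundary is a sum of multiples of coordinates by
elements of [l]. *)
Lemma kall_kdiff N N' l (u : koszul M l) : zsub N' ->
  (forall x, x \in l -> forall z, N z -> N' (x *: z)) ->
  kall N u -> kall N' (kdiff u).
Proof.
move=> hN'; elim: l u => [|x l IH] u hx /=; first by move=> _; apply: zsub0.
move=> [u1 u2]; have hl y : y \in l -> forall z, N z -> N' (y *: z).
  by move=> yl; apply: hx; rewrite inE yl orbT.
have hg := kall_zsub l hN'; split; last by apply: (zsubN hg); apply: IH.
apply: (zsubD hg); first exact: IH.
by apply/kallZ/(kallW _ u2)/hx; rewrite mem_head.
Qed.

Lemma kall_kin N l z : N 0 -> N z -> kall N (kin l z).
Proof.
move=> N0 Nz; elim: l => [|x l IH] //=; split=> //.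
by apply: (@kallW (eq^~ 0)) => [? ->//|]; apply/kall0.
Qed.

Lemma kdeg_kin l z : kdeg 0 (kin (M:=M) l z).
Proof. by elim: l => [|x l IH] //=. Qed.

Lemma kinP N l (u : koszul M l) : kdeg 0 u -> kall N u -> exists2 z, u = kin l z & N z.
Proof.
elim: l u => [|x l IH] u /=; first by move=> _ Nu; exists u.
case: u => u v /= [hu ->] [Nu _]; have [z -> Nz] := IH _ hu Nu.
by exists z.
Qed.

Lemma kin_inj l : injective (@kin Q M l).
Proof. by elim: l => [|x l IH] u v //= [/IH]. Qed.

Lemma kin_lin l c z1 z2 : kin (M:=M) l (c *: z1 + z2) = c *: kin l z1 + kin l z2.
Proof.
by elim: l => [|x l IH] //=; apply: injective_projections; rewrite /= ?IH ?scaler0 ?addr0.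
Qed.

Lemma kinB l : {morph @kin Q M l : u v / u - v}.
Proof.
by elim: l => [|x l IH] u v //=; rewrite IH; congr (_, _); rewrite subr0.
Qed.

Lemma kin0 l : kin (M:=M) l 0 = 0.
Proof. by rewrite -[X in kin l X](subrr 0) kinB subrr. Qed.

End Koszul.

Section KoszulMap.
Variables (Q : comNzRingType) (M M' : lmodType Q).

Lemma kdeg_kmap (g : M -> M') l i u : g 0 = 0 -> kdeg i u -> kdeg i (kmap g (l:=l) u).
Proof.
move=> g0; have gg k : kmap g (0 : koszul M k) = 0 by elim: k => [|x k IH] //=; rewrite IH.
elim: l i u => [|x l IH] [|i] u //=; first by move->.
  by move=> [hu u0]; split; [exact: IH|rewrite [(u : _ * _).2]u0 gg].
by move=> [hu hv]; split; exact: IH.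
Qed.

Lemma kmap_lin (g : {linear M -> M'}) l c (v w : koszul M l) :
  kmap g (c *: v + w) = c *: kmap g v + kmap g w.
Proof.
elim: l v w => [|x k IH] v w /=; first exact: linearP.
by apply: injective_projections; rewrite /= IH.
Qed.

Lemma kmapB (g : {linear M -> M'}) l : {morph kmap g (l:=l) : u v / u - v}.
Proof. by move=> u v; rewrite addrC -scaleN1r kmap_lin scaleN1r addrC. Qed.

Lemma kmap_kdiff (g : {linear M -> M'}) l (u : koszul M l) : kmap g (kdiff u) = kdiff (kmap g u).
Proof.
have kg0 k : kmap g (0 : koszul M k) = 0 by rewrite -[X in kmap g X](subrr 0) kmapB subrr.
elim: l u => [|x l IH] u /=; first exact: raddf0.
apply: injective_projections; rewrite /= -?IH.
  by rewrite addrC kmap_lin addrC.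
by rewrite -[X in kmap g X]add0r kmapB kg0 sub0r.
Qed.

Lemma kmap_comp (M'' : lmodType Q) (g : M' -> M'') (f : M -> M') l (u : koszul M l) :
  kmap g (kmap f u) = kmap (g \o f) u.
Proof. by elim: l u => [|x l IH] u //=; rewrite !IH. Qed.

End KoszulMap.

(** * Acyclicity for regular sequences *)

Section Acyclic.
Variables (Q : comNzRingType) (M : lmodType Q) (P : int -> M -> Prop).
Hypothesis hP : forall w, zsub (P w).

(** The degree [w] part of the submodule (l) M, when the elements of [l] have
degree 1 and [P] is the grading of [M]. *)
Fixpoint lspan (l : seq Q) (w : int) (z : M) : Prop :=
  if l is x :: l' then
    exists z1 z2, [/\ lspan l' w z1, P (w - 1) z2 & z = z1 + x *: z2]
  else z = 0.

Lemma lspan_kdiff l w z :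
  lspan l w z <-> exists v : koszul M l, [/\ kdeg 1 v, kall (P (w - 1)) v & kdiff v = kin l z].
Proof.
elim: l z => [|x l IH] z /=.
  split=> [->|[v [_ _ ->]]] //; exists 0; split=> //; exact: zsub0.
split=> [[z1 [z2 [/IH[v [hv Pv dv]] P2 ->]]]|[[v t] /= [[hv ht] [Pv Pt] [dv dt]]]].
  exists (v, kin l z2); split=> //=.
  - by split=> //; apply: kdeg_kin.
  - by split=> //; apply: kall_kin => //; apply: zsub0.
  congr (_, _); last by rewrite kdeg_kdiff0 ?oppr0 //; apply: kdeg_kin.
  by rewrite dv addrC -kin_lin addrC.
have [z2 def_t P2] := kinP ht Pt.
have [z1 def_z1 _] := kinP (N:=fun=> True) (kdeg_kdiff hv) (kallT _ (fun=> I)).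
exists z1, z2; split=> //; first by apply/IH; exists v.
by apply: (@kin_inj _ _ l); rewrite addrC kin_lin -def_z1 -def_t addrC.
Qed.

Definition kacyclic l := forall i w (u : koszul M l),
  kdeg i.+1 u -> kall (P w) u -> kdiff u = 0 ->
  exists v, [/\ kdeg i.+2 v, kall (P (w - 1)) v & kdiff v = u].

(** A cycle (u, v) of the cone satisfies du = - x v and dv = 0.  If v has positive
homological degree it is a boundary by acyclicity; in degree 0 regularity of [x]
modulo (l) M makes it one.  Subtracting a boundary one may take v = 0, and then
u is a cycle, hence a boundary. *)
Lemma kacyclic_cons x l :
  (forall w z, P w z -> P (w + 1) (x *: z)) ->
  kacyclic l ->
  (forall w z, P w z -> lspan l (w + 1) (x *: z) -> lspan l w z) ->
  kacyclic (x :: l).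
Proof.
move=> hx acy reg i w [u v] /= [hu hv] [Pu Pv] [du dv].
have {}dv : kdiff v = 0 by rewrite -[kdiff v]opprK dv oppr0.
have [v' [hv' Pv' dv']] :
    exists v', [/\ kdeg i.+1 v', kall (P (w - 1)) v' & kdiff v' = v].
  case: i hu hv => [|i] hu hv; last exact: acy.
  have [z def_v Pz] := kinP hv Pv.
  have [] // := (lspan_kdiff l w z).1; last by move=> v' [? ? ?]; exists v'; rewrite def_v.
  apply: reg => //; apply/lspan_kdiff; exists (- u); split.
  - by apply: (zsubN (@kdeg_zsub _ _ _ _)).
  - by apply: (zsubN (kall_zsub _ (hP _))); rewrite addrK.
  rewrite kdiffN -[x *: z]addr0 kin_lin kin0 addr0 -def_v.
  by apply: (addrI (kdiff u)); rewrite subrr du.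
have [u' [hu' Pu' du']] :
    exists u', [/\ kdeg i.+2 u', kall (P (w - 1)) u' & kdiff u' = u + x *: v'].
  apply: acy.
  - by apply: (zsubD (@kdeg_zsub _ _ _ _)) => //; apply: kdegZ.
  - apply: (zsubD (kall_zsub _ (hP _))) => //; apply/kallZ.
    by apply: kallW Pv' => z /hx; rewrite subrK.
  by rewrite kdiffD kdiffZ dv'.
exists (u', - v'); split => /=.
- by split=> //; apply: (zsubN (@kdeg_zsub _ _ _ _)).
- by split=> //; apply: (zsubN (kall_zsub _ (hP _))).
by rewrite kdiffN opprK dv' du' scalerN addrK.
Qed.

End Acyclic.

(** * Homogeneous polynomials and ideals generated by variables *)

Section Poly.
Variables (K : fieldType) (N : nat).
Local Notation Q := {mpoly K[N]}.
Implicit Types (p q : Q) (d e w : int) (s : seq 'I_N).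

Lemma zhomogE d p :
  zhomog d p <-> forall k : 'X_{1..N}, p@_k != 0 -> Posz (mdeg k) = d.
Proof.
case: d => d /=; split.
- by move=> /dhomogP hp k; rewrite -mcoeff_msupp => /hp ->.
- by move=> h; apply/dhomogP => k; rewrite mcoeff_msupp => /h[].
- by move=> -> k; rewrite mcoeff0 eqxx.
move=> h; apply/mpolyP => k; rewrite mcoeff0; apply/eqP/negPn/negP.
by move/h.
Qed.

Lemma zhomog_zsub d : zsub (@zhomog K N d).
Proof.
split=> [|p q /zhomogE hp /zhomogE hq]; first by apply/zhomogE => k; rewrite mcoeff0 eqxx.
apply/zhomogE => k; rewrite mcoeffB.
by have [->|/hp//] := eqVneq p@_k 0; rewrite sub0r oppr_eq0 => /hq.
Qed.

Lemma zhomog0 d : zhomog d (0 : Q).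
Proof. exact: zsub0 (zhomog_zsub d). Qed.

Lemma zhomogM d e p q : zhomog d p -> zhomog e q -> zhomog (d + e) (p * q).
Proof.
case: d => d; last by move=> -> _; rewrite mul0r; apply: zhomog0.
case: e => e; last by move=> _ ->; rewrite mulr0; apply: zhomog0.
exact: dhomogM.
Qed.

Lemma zhomogC d (c : K) : (d != 0 -> c = 0) -> zhomog d (c%:MP : Q).
Proof.
move=> h; apply/zhomogE => k; rewrite mcoeffC.
case: (eqVneq k 0%MM) => [->|]; last by rewrite mulr0 eqxx.
rewrite mdeg0 mulr1 => c_neq0; apply/esym/eqP; apply: contraNT c_neq0 => /h->.
by rewrite eqxx.
Qed.

Lemma zhomog_coef0 d p : zhomog d p -> d != 0 -> p@_0%MM = 0.
Proof.
move=> /zhomogE h d0; apply/eqP; apply: contraNT d0 => /h <-.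
by rewrite mdeg0.
Qed.

Lemma zhomog_X1 i : zhomog 1 ('X_i : Q).
Proof. by rewrite /= dhomogX /= mdeg1. Qed.

Lemma zhomogX (k : 'X_{1..N}) : zhomog (mdeg k) ('X_[k] : Q).
Proof. by rewrite /= dhomogX. Qed.

Lemma zhomogZ d (c : K) p : zhomog d p -> zhomog d (c *: p).
Proof. by move=> h; rewrite -mul_mpolyC -[d]add0r; apply: zhomogM => //; apply: zhomogC. Qed.

Lemma zhomog_neg d p : (d < 0) -> zhomog d p -> p = 0.
Proof. by case: d. Qed.

Lemma zhomog_const p : zhomog 0 p -> p = (p@_0%MM)%:MP.
Proof.
move=> /zhomogE h; apply/mpolyP => k; rewrite mcoeffC.
case: (eqVneq k 0%MM) => [->|k0]; first by rewrite mulr1.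
rewrite mulr0; apply/eqP; apply: contraNT k0 => /h[/eqP].
by rewrite mdeg_eq0.
Qed.

(** The homogeneous component, with integer degrees as in [zhomog]. *)
Definition zpart d p : Q := if d is Posz k then pihomog mdeg k p else 0.

Lemma zpart_lin d c p q : zpart d (c *: p + q) = c *: zpart d p + zpart d q.
Proof. by case: d => d /=; rewrite ?linearP // scaler0 addr0. Qed.

Lemma zpartB d : {morph zpart d : p q / p - q}.
Proof. by case: d => d p q /=; rewrite ?pihomogB // subr0. Qed.
Lemma zpartD d : {morph zpart d : p q / p + q}.
Proof. by case: d => d p q /=; rewrite ?pihomogD // addr0. Qed.
Lemma zpart0 d : zpart d 0 = 0.
Proof. by case: d => d //=; rewrite pihomog0. Qed.
Lemma zpart_sum d I (r : seq I) (f : I -> Q) :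
  zpart d (\sum_(i <- r) f i) = \sum_(i <- r) zpart d (f i).
Proof. exact: (big_morph _ (zpartD d) (zpart0 d)). Qed.

Lemma zpart_homog d p : zhomog d (zpart d p).
Proof. by case: d => d //=; apply: pihomogP. Qed.

Lemma zpart_id d p : zhomog d p -> zpart d p = p.
Proof. by case: d => d //= h; rewrite pihomog_dE. Qed.

Lemma zpart_ne d e p : zhomog d p -> d != e -> zpart e p = 0.
Proof.
case: e => e //; case: d => d; last by move=> ->; rewrite zpart0.
by move=> h de /=; apply: pihomog_ne0 h.
Qed.

Lemma zpartM d e p q : zhomog e q -> zpart (d + e) (p * q) = zpart d p * q.
Proof.
move=> hq; elim/mpolyind: p => [|c k p _ _ IH]; first by rewrite mul0r !zpart0 mul0r.
rewrite mulrDl -scalerAl !zpart_lin IH mulrDl -scalerAl; congr (_ *: _ + _).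
have h := zhomogM (zhomogX k) hq.
have [<-|ne] := eqVneq (Posz (mdeg k)) d; first by rewrite !zpart_id //; apply: zhomogX.
rewrite (zpart_ne h) ?(zpart_ne (zhomogX k)) ?mul0r //.
by apply: contraNneq ne => /addIr->.
Qed.

(** The ideal generated by the variables in [s]: every monomial of [p] involves one
of them. *)
Definition var_ideal s p := forall k, p@_k != 0 -> exists2 i, i \in s & (k i != 0)%N.

Definition varseq s : seq Q := [seq 'X_i | i <- s].

Lemma var_ideal_zsub s : zsub (var_ideal s).
Proof.
split=> [|p q hp hq] k; first by rewrite mcoeff0 eqxx.
rewrite mcoeffB; have [->|/hp//] := eqVneq p@_k 0.
by rewrite sub0r oppr_eq0 => /hq.
Qed.

Lemma var_ideal_nil p : var_ideal [::] p <-> p = 0.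
Proof.
split=> [h|-> k]; last by rewrite mcoeff0 eqxx.
by apply/mpolyP => k; rewrite mcoeff0; apply/eqP/negPn/negP => /h[].
Qed.

Lemma var_idealW s s' p : {subset s <= s'} -> var_ideal s p -> var_ideal s' p.
Proof. by move=> ss h k /h[i /ss]; exists i. Qed.

Lemma var_idealM s p q : var_ideal s q -> var_ideal s (p * q).
Proof.
move=> hq k; rewrite -mcoeff_msupp => /msuppM_le/allpairsP[[k1 k2] /= [_ k2q ->]].
have [|i si ki] := hq k2; first by rewrite -mcoeff_msupp.
by exists i => //; rewrite mnmDE addn_eq0 negb_and ki orbT.
Qed.

Lemma var_idealZ s c p : var_ideal s p -> var_ideal s (c *: p).
Proof. by rewrite -mul_mpolyC; apply: var_idealM. Qed.

Lemma var_idealX s i : i \in s -> var_ideal s 'X_i.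
Proof.
move=> si k; rewrite mcoeffX; case: (U_(i)%MM =P k) => [<- _|_]; last by rewrite eqxx.
by exists i => //; rewrite mnm1E eqxx.
Qed.

(** A variable outside [s] is regular modulo the ideal generated by [s]. *)
Lemma var_ideal_reg s i p : i \notin s -> var_ideal s ('X_i * p) -> var_ideal s p.
Proof.
move=> si h k pk; have [|j sj] := h (k + U_(i))%MM.
  by rewrite mulrC addmC mcoeffMX.
rewrite mnmDE mnm1E; case: (i =P j) => [e|_]; last by rewrite addn0; exists j.
by rewrite e sj in si.
Qed.

Lemma var_ideal_all p : p@_0%MM = 0 -> var_ideal (enum 'I_N) p.
Proof.
move=> p0 k pk; case: (pickP (fun i => k i != 0%N)) => [i ki|k0].
  by exists i; rewrite ?mem_enum.
have k00 : k = 0%MM by apply/mnmP => i; rewrite mnm0E; apply/eqP/negbFE/k0.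
by rewrite k00 p0 eqxx in pk.
Qed.

Local Notation lspanQ := (@lspan Q Q^o (@zhomog K N)).

Lemma lspan_var_ideal s w p : lspanQ (varseq s) w p <-> var_ideal s p /\ zhomog w p.
Proof.
split.
  elim: s p => [|i s IH] p /=.
    by move=> ->; split; [apply/var_ideal_nil|apply: zhomog0].
  move=> [p1 [p2 [/IH[h1 z1] z2 ->]]]; split.
    apply: (zsubD (var_ideal_zsub _)).
      by apply: var_idealW h1 => j sj; rewrite inE sj orbT.
    by rewrite -[_ *: _]/('X_i * p2) mulrC; apply/var_idealM/var_idealX/mem_head.
  apply: (zsubD (zhomog_zsub _)) => //.
  have -> : w = 1 + (w - 1) by rewrite addrC subrK.
  exact/zhomogM/z2/zhomog_X1.
have l0 t v : lspanQ (varseq t) v 0.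
  elim: t => [|i t IH] //=; exists 0, 0; split=> //; first exact: zhomog0.
  by rewrite scaler0 addr0.
have lD t v u u' : lspanQ (varseq t) v u -> lspanQ (varseq t) v u' -> lspanQ (varseq t) v (u + u').
  elim: t u u' => [|i t IH] u u' /=; first by move=> -> ->; rewrite addr0.
  move=> [u1 [u2 [h1 h2 ->]]] [u1' [u2' [h1' h2' ->]]].
  exists (u1 + u1'), (u2 + u2'); split; first exact: IH.
    exact: (zsubD (zhomog_zsub _)).
  by rewrite scalerDr addrACA.
move=> [hp /zhomogE zp]; rewrite [p]mpolyE big_seq.
elim/big_ind: _ => [|u v|k]; [exact: l0|exact: lD|].
rewrite mcoeff_msupp => pk; rewrite -(zp k pk); move: (p@_k) => c.
have {hp} [i si ki] := hp k pk.
elim: s si => [|j s IH] //=; rewrite inE; case: eqP => [e _|_ /= si]; last first.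
  exists (c *: 'X_[k]), 0; split; [exact: IH|exact: zhomog0|].
  by rewrite scaler0 addr0.
rewrite {}e in ki *; exists 0, (c *: 'X_[k - U_(j)]); split; first exact: l0.
  apply: zhomogZ; have -> : Posz (mdeg k) - 1 = Posz (mdeg (k - U_(j))%MM).
    by have := mdegD (k - U_(j)) U_(j); rewrite submK ?lep1mP // mdeg1 => ->; rewrite PoszD addrK.
  exact: zhomogX.
rewrite add0r -[RHS]/('X_j * (c *: _)) -scalerAr -mpolyXD addmC submK //.
by rewrite lep1mP.
Qed.

Lemma zhomog_mulX i d p : zhomog d p -> zhomog (d + 1) ('X_i * p).
Proof. by move=> h; rewrite addrC; apply/zhomogM/h/zhomog_X1. Qed.

Lemma kacyclicQ s : uniq s -> kacyclic (M:=Q^o) (@zhomog K N) (varseq s).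
Proof.
elim: s => [|i s IH] /=; first by move=> _ j w u /= -> _ _; exists 0; split=> //; apply: zhomog0.
move=> /andP[si us]; apply: kacyclic_cons.
- exact: zhomog_zsub.
- by move=> w z; apply: zhomog_mulX.
- exact: IH.
move=> w z hz /lspan_var_ideal[hc _]; apply/lspan_var_ideal; split=> //.
exact: var_ideal_reg hc.
Qed.

Definition vars : seq Q := varseq (enum 'I_N).

Local Notation kallQ N := (@kall Q Q^o N _).

Lemma kallQ_zhomog w l : zsub (@kall Q Q^o (zhomog w) l).
Proof. exact/kall_zsub/zhomog_zsub. Qed.

Lemma kallQ_var_ideal s l : zsub (@kall Q Q^o (var_ideal s) l).
Proof. exact/kall_zsub/var_ideal_zsub. Qed.

(** The Koszul complex of the polynomial ring resolves K, which lives in weight 0. *)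
Lemma kos_exact i w (u : koszul Q^o vars) : (0 < i)%N || (0 < w) ->
  kdeg i u -> kallQ (zhomog w) u -> kdiff u = 0 ->
  exists v, [/\ kdeg i.+1 v, kallQ (zhomog (w - 1)) v & kdiff v = u].
Proof.
case: i => [|i] /=; last by move=> _; apply/kacyclicQ/enum_uniq.
move=> w0 hu zu _; have [z -> hz] := kinP hu zu.
have H := @lspan_kdiff Q Q^o (@zhomog K N) zhomog_zsub vars w z.
apply: H.1; apply/lspan_var_ideal; split=> //.
by apply: var_ideal_all; apply: zhomog_coef0 hz _; rewrite gt_eqF.
Qed.

Lemma kall_zhomog_kdiff w (u : koszul Q^o vars) :
  kallQ (zhomog w) u -> kallQ (zhomog (w + 1)) (kdiff u).
Proof.
apply: kall_kdiff; first exact: zhomog_zsub.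
by move=> x /mapP[i _ ->] z; apply: zhomog_mulX.
Qed.

Lemma kall_var_ideal_kdiff s (u : koszul Q^o vars) : kallQ (var_ideal s) u -> kallQ (var_ideal s) (kdiff u).
Proof.
apply: kall_kdiff; first exact: var_ideal_zsub.
by move=> x _ z; apply: var_idealM.
Qed.

(** The quotient of [Q] by some of the variables has a linear resolution: its
Koszul homology vanishes in positive weight.  Induction on [s]: if x is regular
modulo the ideal I_s and u is a cycle modulo I_s + (x), write du = x v modulo I_s.
Then v is a cycle modulo I_s, of positive weight, so v = dv' modulo I_s; and
u - x v' is a cycle modulo I_s, hence a boundary modulo I_s. *)
Lemma kos_linear s i w (u : koszul Q^o vars) : uniq s -> 0 < w ->
  kdeg i u -> kallQ (zhomog w) u -> kallQ (var_ideal s) (kdiff u) ->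
  exists v, [/\ kdeg i.+1 v, kallQ (zhomog (w - 1)) v & kallQ (var_ideal s) (u - kdiff v)].
Proof.
move=> + w0; elim: s i w w0 u => [|k s IH] i w w0 u /=.
  move=> _ hu zu du; have [||v [hv zv dv]] := kos_exact (i:=i) _ hu zu.
  - by rewrite w0 orbT.
  - by apply/kall0/kallW/du => z /var_ideal_nil.
  exists v; split=> //; rewrite dv subrr.
  by apply: (zsub0 (kallQ_var_ideal _ _)).
move=> /andP[sk us] hu zu du.
have [||g g0 hg] := @pointed_choice Q^o Q^o (fun z => var_ideal (k :: s) z /\ zhomog (w + 1) z)
    (fun z y => zhomog w y /\ var_ideal s (z - 'X_k * y)).
- move=> z [h1 h2].
  have [/= z1 [z2 [/lspan_var_ideal[h _] hz2 ->]]] := (lspan_var_ideal (k :: s) _ _).2 (conj h1 h2).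
  by exists z2; rewrite addrK; rewrite addrK in hz2.
- by rewrite mulr0 subr0; split; [apply: zhomog0|apply: (zsub0 (var_ideal_zsub _))].
case: i hu => [|i] hu.
  have [|v [hv zv dv]] := IH 0%N w w0 u us hu zu.
    by rewrite kdeg_kdiff0 //; apply: (zsub0 (kallQ_var_ideal _ _)).
  exists v; split=> //; apply: kallW dv => z; apply: var_idealW => j js.
  by rewrite inE js orbT.
have zdu := kall_zhomog_kdiff zu.
pose v := kmap g (kdiff u).
have hv : kdeg i v by apply: kdeg_kmap => //; apply: kdeg_kdiff.
have zv : kallQ (zhomog w) v.
  apply/kall_kmap; apply: kallW ((kall_and _ _ _).2 (conj du zdu)) => z [h1 h2].
  by case: (hg z (conj h1 h2)).
have mk := kallQ_var_ideal s vars.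
have duv : kallQ (var_ideal s) (kdiff u - 'X_k *: v).
  apply: kallBf ((kall_and _ _ _).2 (conj du zdu)) => z [h1 h2].
  by case: (hg z (conj h1 h2)).
have dv : kallQ (var_ideal s) (kdiff v).
  have : kallQ (var_ideal s) ('X_k *: kdiff v).
    rewrite -kdiffZ -[_ *: v](subKr (kdiff u)) kdiffB kdiffK sub0r.
    exact/(zsubN (kallQ_var_ideal _ _))/kall_var_ideal_kdiff.
  by move=> /kallZ; apply: kallW => z; apply: var_ideal_reg.
have [v' [hv' zv' dv']] := IH i w w0 v us hv zv dv.
have [|||v'' [hv'' zv'' dv'']] := IH i.+1 w w0 (u - 'X_k *: v') us.
- by apply: (zsubB (@kdeg_zsub _ _ _ _)); [|apply: kdegZ].
- apply: (zsubB (kallQ_zhomog _ _)); [exact: zu|apply/kallZ].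
  by apply: kallW zv' => z /(zhomog_mulX k); rewrite subrK.
- rewrite kdiffB kdiffZ -[kdiff u](subrK ('X_k *: v)) -addrA -scalerBr.
  apply: (zsubD mk); [exact: duv|apply/kallZ].
  by apply: kallW dv' => z; apply: var_idealM.
exists v''; split=> //.
have -> : u - kdiff v'' = (u - 'X_k *: v' - kdiff v'') + 'X_k *: v'.
  by rewrite addrAC subrK.
apply: (zsubD (kallQ_var_ideal _ _)).
  by apply: kallW dv'' => z; apply: var_idealW => j js; rewrite inE js orbT.
by apply/kallZ/kallT => z; rewrite -[_ *: _]/('X_k * z) mulrC; apply/var_idealM/var_idealX/mem_head.
Qed.

End Poly.

Arguments zhomog_zsub {K N} d.
Arguments var_ideal_zsub {K N} s.
Arguments kallQ_zhomog {K N} w l.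
Arguments kallQ_var_ideal {K N} s l.
Arguments zhomog0 {K N} d.

(** * Graded free modules *)

Section Rows.
Variables (K : fieldType) (N r : nat) (dg : 'I_r -> int).
Local Notation Q := {mpoly K[N]}.
Local Notation F := 'rV[Q]_r.

(** The degree [w] part of the graded free module whose k-th basis vector has
degree [dg k]. *)
Definition grow (w : int) (u : F) : Prop := forall k, zhomog (w - dg k) (u 0 k).

Definition rowc (k : 'I_r) (u : F) : Q^o := u 0 k.
Fact rowc_linear k : linear (rowc k).
Proof. by move=> c u v; rewrite /rowc !mxE. Qed.
HB.instance Definition _ k := GRing.isLinear.Build Q F Q^o *:%R (rowc k) (rowc_linear k).

Definition rowi (k : 'I_r) (q : Q^o) : F := q *: delta_mx 0 k.
Fact rowi_linear k : linear (rowi k).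
Proof. by move=> c u v; rewrite /rowi scalerDl scalerA. Qed.
HB.instance Definition _ k := GRing.isLinear.Build Q Q^o F *:%R (rowi k) (rowi_linear k).

Lemma grow_zsub w : zsub (grow w).
Proof.
split=> [k|u v hu hv k]; rewrite !mxE; first exact: zhomog0.
exact: (zsubB (zhomog_zsub _) (hu k) (hv k)).
Qed.

Lemma grow_mulX i w u : grow w u -> grow (w + 1) ('X_i *: u).
Proof.
move=> h k; rewrite mxE addrAC; exact: zhomog_mulX.
Qed.

Lemma kall_grow_zsub w l : zsub (@kall Q F (grow w) l).
Proof. exact/kall_zsub/grow_zsub. Qed.

Lemma kall_grow_kdiff w (u : koszul F (vars K N)) : kall (grow w) u -> kall (grow (w + 1)) (kdiff u).
Proof.
apply: kall_kdiff; first exact: grow_zsub.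
by move=> x /mapP[i _ ->] z; apply: grow_mulX.
Qed.

(** Reduces statements on free modules to the case of rank one. *)
Lemma kmap_rowsum l (u : koszul F l) : u = \sum_k kmap (rowi k) (kmap (rowc k) u).
Proof.
elim: l u => [|x l IH] u /=.
  by rewrite {1}[u]matrix_sum_delta big_ord1; apply: eq_bigr.
have sumE I (s : seq I) (A : I -> koszul F l) (B : I -> koszul F l) :
    \sum_(k <- s) ((A k, B k) : koszul F (x :: l)) = (\sum_(k <- s) A k, \sum_(k <- s) B k).
  elim: s => [|a s IHs]; first by rewrite !big_nil.
  by rewrite !big_cons IHs.
by rewrite sumE -!IH; case: u.
Qed.

Lemma kacyclic_row : kacyclic grow (vars K N).
Proof.
move=> i w u hu gu du.
have h k : exists v, [/\ kdeg i.+2 v, @kall Q Q^o (zhomog (w - 1 - dg k)) _ v &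
    kdiff v = kmap (rowc k) u].
  have [|||v [hv zv dv]] := @kacyclicQ K N (enum 'I_N) (enum_uniq _) i (w - dg k) (kmap (rowc k) u).
  - by apply: kdeg_kmap => //; rewrite raddf0.
  - by apply/kall_kmap; apply: kallW gu => z; apply.
  - by rewrite -kmap_kdiff du -(subrr 0) kmapB subrr.
  by exists v; split=> //; rewrite addrAC.
have [v hv] := choice h.
exists (\sum_k kmap (rowi k) (v k)); split.
- apply: (zsub_sum (@kdeg_zsub _ _ _ _)) => k _.
  by apply: kdeg_kmap; [rewrite raddf0|case: (hv k)].
- apply: (zsub_sum (kall_grow_zsub _ _)) => k _; apply/kall_kmap.
  have [_ + _] := hv k; apply: kallW => z hz j.
  rewrite !mxE eqxx /=; case: eqP => [->|_]; first by rewrite mulr1.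
  by rewrite mulr0; apply: zhomog0.
rewrite [RHS]kmap_rowsum (big_morph _ (kdiffD (l := _)) (kdiff0 _ _)).
by apply: eq_bigr => k _; rewrite -kmap_kdiff; case: (hv k) => _ _ ->.
Qed.

End Rows.

Arguments grow_zsub {K N r} dg w.

(** * Isomorphisms between subquotients *)

Import passmx.

Section Subquotients.
Variable K : fieldType.

(** A subquotient [cyc] / [bnd] of a space with an action of [K].  The homology groups
are subquotients of infinite dimensional spaces of polynomial chains; they are
compared with finite dimensional spaces through [subquo_vs]. *)
Record subquo := Subquo {
  car : zmodType;
  act : K -> car -> car;
  cyc : car -> Prop;
  bnd : car -> Prop;
  cyc_lin : forall c u v, cyc u -> cyc v -> cyc (act c u + v)
}.
Implicit Types X Y : subquo.

(** An isomorphism of subquotients is given by a linear relation, as zigzags in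
double complexes produce relations and not maps. *)
Definition subquo_iso X Y := exists r : car X -> car Y -> Prop,
 [/\ forall c u v u' v', r u u' -> r v v' -> r (act c u + v) (act c u' + v'),
     forall u, cyc u -> exists2 v, cyc v & r u v,
     forall v, cyc v -> exists2 u, cyc u & r u v
   & forall u v, cyc u -> cyc v -> r u v -> (bnd u <-> bnd v)].

Lemma subquo_iso_sym X Y : subquo_iso X Y -> subquo_iso Y X.
Proof.
move=> [r [h1 h2 h3 h4]]; exists (fun u v => r v u); split=> //.
- by move=> c u v u' v'; apply: h1.
- by move=> u v cu cv /(h4 _ _ cv cu) [? ?].
Qed.

Lemma subquo_iso_trans Y X Z : subquo_iso X Y -> subquo_iso Y Z -> subquo_iso X Z.
Proof.
move=> [r [r1 r2 r3 r4]] [s [s1 s2 s3 s4]].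
exists (fun u w => exists v, [/\ cyc v, r u v & s v w]); split.
- move=> c u v u' v' [t [ct ru st]] [t' [ct' ru' st']].
  by exists (act c t + t'); split; [apply: cyc_lin|apply: r1|apply: s1].
- move=> u /r2[v cv ruv]; have [w cw svw] := s2 v cv.
  by exists w => //; exists v.
- move=> w /s3[v cv svw]; have [u cu ruv] := r3 v cv.
  by exists u => //; exists v.
move=> u w cu cw [v [cv ruv svw]].
by rewrite (r4 u v cu cv ruv) (s4 v w cv cw svw).
Qed.

Lemma subquo_iso_id (V : zmodType) (a : K -> V -> V) (Z B Z' B' : V -> Prop) hZ hZ' :
  (forall u, Z u <-> Z' u) -> (forall u, Z u -> (B u <-> B' u)) ->
  subquo_iso (@Subquo V a Z B hZ) (@Subquo V a Z' B' hZ').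
Proof.
move=> hz hb; exists (fun u v => u = v); split=> /=.
- by move=> c u v _ _ <- <-.
- by move=> u /hz; exists u.
- by move=> u /hz; exists u.
by move=> u v zu _ <-; apply: hb.
Qed.

(** An isomorphism restricts to the subspaces cut out by conditions that it
exchanges. *)
Lemma subquo_iso_cut X (C : car X -> Prop) hC Y (C' : car Y -> Prop) hC'
    (r : car X -> car Y -> Prop) :
  [/\ forall c u v u' v', r u u' -> r v v' -> r (act c u + v) (act c u' + v'),
     forall u, cyc u -> exists2 v, cyc v & r u v,
     forall v, cyc v -> exists2 u, cyc u & r u v
   & forall u v, cyc u -> cyc v -> r u v -> (bnd u <-> bnd v)] ->
  (forall u v, cyc u -> cyc v -> r u v -> (C u <-> C' v)) ->
  subquo_iso (@Subquo (car X) (@act X) (fun u => cyc u /\ C u) (@bnd X) hC)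
        (@Subquo (car Y) (@act Y) (fun u => cyc u /\ C' u) (@bnd Y) hC').
Proof.
move=> [r1 r2 r3 r4] h; exists r; split=> //=.
- move=> u [cu Cu]; have [v cv ruv] := r2 u cu.
  by exists v => //; split=> //; apply/(h u v cu cv ruv).
- move=> v [cv Cv]; have [u cu ruv] := r3 v cv.
  by exists u => //; split=> //; apply/(h u v cu cv ruv).
by move=> u v [cu _] [cv _]; apply: r4.
Qed.

Definition subquo_vs (V : lmodType K) : subquo :=
  @Subquo V *:%R (fun=> True) (fun v => v = 0) (fun _ _ _ _ _ => I).

Lemma subquo_iso_vs (V W : lmodType K) : subquo_iso (subquo_vs V) (subquo_vs W) -> vs_iso V W.
Proof.
move=> [r [/= r1 r2 r3 r4]].
have [f hf] : exists f : V -> W, forall v, r v (f v).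
  have [|f hf] := @choice _ _ (fun v w => r v w); last by exists f.
  by move=> v; have [w _ ?] := r2 v I; exists w.
have r1' v w w' : r v w -> r v w' -> w = w'.
  move=> h h'; have := r1 (-1) _ _ _ _ h h'; rewrite !scaleN1r addNr => h0.
  by apply/eqP; rewrite -subr_eq0 -opprB oppr_eq0 addrC; apply/eqP/(r4 0 _ I I h0).
have f_lin : linear f.
  by move=> c u v; apply: (r1' (c *: u + v)); [apply: hf|apply: r1].
pose fL : {linear V -> W} := HB.pack f (GRing.isLinear.Build K V W *:%R f f_lin).
have f_inj : injective f.
  move=> u v e; apply/eqP; rewrite -subr_eq0; apply/eqP.
  apply/(r4 _ 0 I I) => //; have := r1 (-1) _ _ _ _ (hf v) (hf u).
  by rewrite e !scaleN1r addNr addrC.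
have f_surj w : exists v, f v = w.
  by have [v _ rvw] := r3 w I; exists v; apply: r1' (hf v) rvw.
have [g hg] := choice f_surj.
by exists fL; exists g => [u|w] /=; [apply: f_inj; rewrite hg|rewrite hg].
Qed.

Lemma vs_iso_dim (V W : vectType K) : vs_iso V W -> \dim {: V} = \dim {: W}.
Proof.
move=> [f bf]; pose F : 'Hom(V, W) := linfun f.
have kF : lker F == 0%VS.
  apply/lker0P => u v; rewrite !lfunE; exact: bij_inj.
rewrite -(limg_dim_eq (f := F)) ?(eqP kF) ?capv0 //; congr (\dim _); apply/vspaceP => w.
rewrite memvf; apply/memv_imgP; have [g fK gK] := bf.
by exists (g w); rewrite ?memvf // lfunE /= gK.
Qed.

Lemma dim_vs_iso (V W : vectType K) : \dim {: V} = \dim {: W} -> vs_iso V W.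
Proof.
move=> e; have [bV bW] := (vbasisP {:V}, vbasisP {:W}).
pose f (v : V) : W := vecof (vbasis {:W}) (castmx (erefl, e) (rVof (vbasis {:V}) v)).
have f_lin : linear f.
  move=> c u v; rewrite /f -linearP; congr vecof.
  by apply/rowP => k; rewrite !(castmxE, linearP, mxE).
pose fL : {linear V -> W} := HB.pack f (GRing.isLinear.Build K V W *:%R f f_lin).
pose g (w : W) : V :=
  vecof (vbasis {:V}) (castmx (esym erefl, esym e) (rVof (vbasis {:W}) w)).
by exists fL, g => v /=; rewrite /f /g vecofK // ?castmxK ?castmxKV rVofK.
Qed.

Lemma subquo_iso_dim (V W : vectType K) : subquo_iso (subquo_vs V) (subquo_vs W) -> \dim {: V} = \dim {: W}.
Proof. by move/subquo_iso_vs/vs_iso_dim. Qed.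

Lemma subquo_iso_zero X (V : vectType K) : subquo_iso X (subquo_vs V) ->
  (forall v : V, v = 0) <-> (forall u, @cyc X u -> bnd u).
Proof.
move=> [r [_ r2 r3 r4]]; split=> h.
  by move=> u cu; have [v _ ruv] := r2 u cu; apply/(r4 u v cu I ruv)/h.
by move=> v; have [u cu ruv] := r3 v I; apply/(r4 u v cu I ruv)/h.
Qed.

Lemma dim_zero (V : vectType K) : (forall v : V, v = 0) <-> \dim {: V} = 0%N.
Proof.
split=> [h|/eqP]; last by rewrite dimv_eq0 => /eqP h v; apply/eqP; rewrite -memv0 -h memvf.
apply/eqP; rewrite dimv_eq0; apply/eqP/vspaceP => v.
by rewrite memvf memv0 [v]h eqxx.
Qed.

Lemma subquo_prod_lin X Y c (u v : car X * car Y) :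
  cyc u.1 /\ cyc u.2 -> cyc v.1 /\ cyc v.2 ->
  cyc (act c u.1 + v.1) /\ cyc (act c u.2 + v.2).
Proof. by move=> [? ?] [? ?]; split; apply: cyc_lin. Qed.

Definition subquo_prod X Y : subquo :=
  @Subquo (car X * car Y)%type (fun c u => (act c u.1, act c u.2))
    (fun u => cyc u.1 /\ cyc u.2) (fun u => bnd u.1 /\ bnd u.2)
    (@subquo_prod_lin X Y).

Lemma subquo_iso_prod X Y X' Y' :
  subquo_iso X X' -> subquo_iso Y Y' -> subquo_iso (subquo_prod X Y) (subquo_prod X' Y').
Proof.
move=> [r [r1 r2 r3 r4]] [s [s1 s2 s3 s4]].
exists (fun u v => r u.1 v.1 /\ s u.2 v.2); split=> /=.
- by move=> c u v u' v' [? ?] [? ?]; split; [apply: r1|apply: s1].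
- move=> u [/r2[v cv rv] /s2[w cw rw]]; by exists (v, w).
- move=> u [/r3[v cv rv] /s3[w cw rw]]; by exists (v, w).
by move=> u v [? ?] [? ?] [? ?]; rewrite (r4 u.1 v.1) ?(s4 u.2 v.2).
Qed.

Lemma subquo_iso_prodV (V W : lmodType K) :
  subquo_iso (subquo_prod (subquo_vs V) (subquo_vs W)) (subquo_vs (V * W)%type).
Proof.
exists (fun u v => u = v); split=> /=.
- by move=> c u v _ _ <- <-.
- by move=> u _; exists u.
- by move=> u _; exists u.
by move=> [u1 u2] v _ _ <- /=; split=> [[-> ->]|[-> ->]].
Qed.

(** For B <= W <= Z the dimension of Z / B is the sum of those of Z / W and W / B.
The relations between T, Z and S compose to a linear surjection from T onto S whose
kernel is W / B. *)
Lemma subquo_dim_ext (V : zmodType) (a : K -> V -> V) (Z W B : V -> Prop)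
  (hZ : forall c u v, Z u -> Z v -> Z (a c u + v))
  (hW : forall c u v, W u -> W v -> W (a c u + v)) (T S U : vectType K) :
  (forall u, W u -> Z u) -> (forall u, Z u -> B u -> W u) ->
  subquo_iso (@Subquo V a Z B hZ) (subquo_vs T) -> subquo_iso (@Subquo V a Z W hZ) (subquo_vs S) ->
  subquo_iso (@Subquo V a W B hW) (subquo_vs U) ->
  \dim {: T} = (\dim {: S} + \dim {: U})%N.
Proof.
move=> WZ BW [r [/= r1 r2 r3 r4]] [s [/= s1 s2 s3 s4]] isoU.
have [f hf] : exists f : T -> S, forall t, exists u, [/\ Z u, r u t & s u (f t)].
  have [|f hf] := @choice _ _ (fun t x => exists u, [/\ Z u, r u t & s u x]); last by exists f.
  by move=> t; have [u zu ru] := r3 t I; have [x _ sx] := s2 u zu; exists x, u.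
have f_uniq t u x : Z u -> r u t -> s u x -> f t = x.
  move=> zu ru sx; have [u' [zu' ru' sx']] := hf t.
  have h0 : W (a (-1) u + u').
    apply: (BW _ (hZ _ _ _ zu zu')); apply/(r4 _ 0 (hZ _ _ _ zu zu') I) => //.
    by have := r1 (-1) _ _ _ _ ru ru'; rewrite scaleN1r addNr.
  have := s4 _ _ (hZ (-1) _ _ zu zu') I (s1 (-1) _ _ _ _ sx sx').
  rewrite scaleN1r => -[/(_ h0) e _]; apply/eqP.
  by rewrite -subr_eq0 addrC e eqxx.
have f_lin : linear f.
  move=> c t t'; have [u [zu ru su]] := hf t; have [u' [zu' ru' su']] := hf t'.
  by apply: (f_uniq _ (a c u + u') _ (hZ _ _ _ zu zu')); [apply: r1|apply: s1].
pose fL : {linear T -> S} := HB.pack f (GRing.isLinear.Build K T S *:%R f f_lin).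
pose F : 'Hom(T, S) := linfun fL.
have FE t : F t = f t by rewrite lfunE.
have imF : (F @: fullv = fullv)%VS.
  apply/vspaceP => x; rewrite memvf; apply/memv_imgP.
  have [u zu su] := s3 x I; have [t _ ru] := r2 u zu.
  by exists t; rewrite ?memvf // FE; apply/esym/f_uniq/su.
have <- : \dim (lker F) = \dim {: U}.
  have -> : \dim (lker F) = \dim {: subvs_of (lker F)} by rewrite dimvf.
  apply/subquo_iso_dim/(subquo_iso_trans _ isoU).
  exists (fun x u => Z u /\ r u (vsval x)); split=> /=.
  - move=> c x y u v [zu ru] [zv rv]; split; first exact: (hZ _ _ _ zu zv).
    exact: r1.
  - move=> x _; have [u [zu ru su]] := hf (vsval x); exists u => //.
    by apply/(s4 u _ zu I su); rewrite -FE; apply/eqP; rewrite -memv_ker subvsP.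
  - move=> u wu; have zu := WZ u wu; have [t _ ru] := r2 u zu.
    have [x _ su] := s2 u zu.
    have tker : t \in lker F.
      by rewrite memv_ker FE (f_uniq t u x) //; apply/eqP/(s4 u x zu I su).
    by exists (Subvs tker).
  move=> x u _ _ [zu ru]; rewrite (r4 u _ zu I ru).
  by split=> [->|h]; [rewrite linear0|apply: val_inj].
by rewrite -imF addnC -(limg_ker_dim F fullv) capfv.
Qed.

End Subquotients.

(** * Koszul homology and syzygies *)

Section Balancing.
Variables (K : fieldType) (N : nat).
Local Notation Q := {mpoly K[N]}.
Local Notation vs := (vars K N).

(** [K]-subspaces of a [Q]-module. *)
Definition lin_pred (M : lmodType Q) (P : M -> Prop) : Prop :=
  P 0 /\ forall (c : K) u v, P u -> P v -> P (c%:MP *: u + v).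

Lemma lin_pred_zsub (M : lmodType Q) (P : M -> Prop) : lin_pred P -> zsub P.
Proof.
move=> [P0 h]; split=> // u v Pu Pv; rewrite addrC.
by have := h (-1) _ _ Pv Pu; rewrite mpolyCN mpolyC1 scaleN1r.
Qed.

Lemma lin_pred_kall (M : lmodType Q) (P : M -> Prop) l : lin_pred P -> lin_pred (@kall Q M P l).
Proof.
move=> hP; split=> [|c u v]; first exact: (zsub0 (kall_zsub l (lin_pred_zsub hP))).
by apply: kall_lin; case: hP => _; apply.
Qed.

Lemma lin_pred_eq0 (M : lmodType Q) : lin_pred (fun z : M => z = 0).
Proof. by split=> // c u v -> ->; rewrite scaler0 addr0. Qed.

Lemma lin_pred_zhomog w : @lin_pred Q^o (zhomog w).
Proof.
split=> [|c u v hu hv]; first exact: zhomog0.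
apply: (zsubD (zhomog_zsub _) _ hv).
by rewrite -[_ *: _]/(c%:MP * u) mul_mpolyC; apply: zhomogZ.
Qed.

Lemma lin_pred_grow r (dg : 'I_r -> int) w : lin_pred (grow (N:=N) (K:=K) dg w).
Proof.
split=> [k|c u v hu hv k]; first by rewrite mxE; apply: zhomog0.
by have [_] := lin_pred_zhomog (w - dg k); rewrite !mxE; apply.
Qed.

Section koszulH.
Variables (M : lmodType Q) (L : int -> M -> Prop) (I : M -> Prop).
Hypotheses (hL : forall w, lin_pred (L w)) (hI : lin_pred I).

(** Cycles of homological degree [i] and weight [w] in the Koszul complex of the
module [L] / [I]. *)
Definition koszulH_cyc i w (u : koszul M vs) :=
  [/\ kdeg i u, kall (L w) u & kall I (kdiff u)].
Definition koszulH_bnd i w (u : koszul M vs) :=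
  exists v, [/\ kdeg i.+1 v, kall (L (w - 1)) v & kall I (u - kdiff v)].

Lemma koszulH_cyc_lin i w (c : K) u v :
  koszulH_cyc i w u -> koszulH_cyc i w v -> koszulH_cyc i w (c%:MP *: u + v).
Proof.
move=> [u1 u2 u3] [v1 v2 v3]; split; first exact: kdeg_lin.
  by apply: (lin_pred_kall _ (hL w)).2.
by rewrite kdiff_lin; apply: (lin_pred_kall _ hI).2.
Qed.

Definition koszulH i w : subquo K :=
  @Subquo K (koszul M vs) (fun c u => c%:MP *: u) (koszulH_cyc i w) (koszulH_bnd i w) (@koszulH_cyc_lin i w).

End koszulH.

Section syzH.
Variables (G : lmodType Q) (P Z : int -> G -> Prop).
Hypotheses (hP : forall w, lin_pred (P w)) (hZ : forall w, lin_pred (Z w)).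

(** For Z inside P: the chains of Z that are boundaries in the complex of P.  Modulo
the boundaries of Z, this is the homology of Z in positive degree when P is
acyclic ([syzH_koszulH]); in degree 0 it is the kernel of
Z / (variables) Z -> P / (variables) P.  Both ends of the dimension shifting are
covered by this definition. *)
Definition syzH_cyc i w (y : koszul G vs) :=
  [/\ kdeg i y, kall (Z w) y & exists x, [/\ kdeg i.+1 x, kall (P (w - 1)) x & kdiff x = y]].
Definition syzH_bnd i w (y : koszul G vs) :=
  exists x, [/\ kdeg i.+1 x, kall (Z (w - 1)) x & kdiff x = y].

Lemma syzH_cyc_lin i w (c : K) u v :
  syzH_cyc i w u -> syzH_cyc i w v -> syzH_cyc i w (c%:MP *: u + v).
Proof.
move=> [u1 u2 [x [x1 x2 x3]]] [v1 v2 [y [y1 y2 y3]]]; split; first exact: kdeg_lin.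
  by apply: (lin_pred_kall _ (hZ w)).2.
exists (c%:MP *: x + y); split; first exact: kdeg_lin.
  by apply: (lin_pred_kall _ (hP _)).2.
by rewrite kdiff_lin x3 y3.
Qed.

Definition syzH i w : subquo K :=
  @Subquo K (koszul G vs) (fun c u => c%:MP *: u) (syzH_cyc i w) (syzH_bnd i w) (@syzH_cyc_lin i w).

Lemma syzH_koszulH i w : (forall w z, Z w z -> P w z) -> kacyclic P vs ->
  subquo_iso (syzH i.+1 w) (koszulH hZ (@lin_pred_eq0 G) i.+1 w).
Proof.
move=> ZP acy; apply: subquo_iso_id => y.
  split=> [[y1 y2 [x [_ _ dx]]]|[y1 y2 y3]]; split=> //.
  - by rewrite -dx kdiffK; apply/kall0.
  - by apply: acy => //; [apply: kallW y2 => z; apply: ZP|apply/kall0].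
move=> _; split=> [[x [x1 x2 x3]]|[x [x1 x2 x3]]]; exists x; split=> //.
  by rewrite x3 subrr; apply/kall0.
by apply/esym/eqP; rewrite -subr_eq0; apply/eqP/kall0.
Qed.

End syzH.

Section Step.
Variables (G M : lmodType Q) (P Z : int -> G -> Prop) (L : int -> M -> Prop).
Variables (I : M -> Prop) (f : {linear G -> M}).
Hypotheses (hP : forall w, lin_pred (P w)) (hZ : forall w, lin_pred (Z w)).
Hypotheses (hL : forall w, lin_pred (L w)) (hI : lin_pred I).
Hypothesis IX : forall i z, I z -> I ('X_i *: z).
Hypothesis PX : forall i w z, P w z -> P (w + 1) ('X_i *: z).
Hypothesis ZE : forall w g, Z w g <-> P w g /\ I (f g).
Hypothesis PL : forall w g, P w g -> L w (f g).
Hypothesis LP : forall w z, L w z -> exists2 g, P w g & I (z - f g).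

Lemma kall_kdiffI (u : koszul M vs) : kall I u -> kall I (kdiff u).
Proof.
by apply: kall_kdiff; [apply: lin_pred_zsub|move=> x /mapP[i _ ->] z; apply: IX].
Qed.

Lemma kall_kdiffP w (u : koszul G vs) : kall (P w) u -> kall (P (w + 1)) (kdiff u).
Proof.
by apply: kall_kdiff; [apply: lin_pred_zsub|move=> x /mapP[i _ ->] z; apply: PX].
Qed.

Lemma kall_lift i w (z : koszul M vs) : kdeg i z -> kall (L w) z ->
  exists x, [/\ kdeg i x, kall (P w) x & kall I (z - kmap f x)].
Proof.
move=> z1 z2; have [||g g0 hg] := @pointed_choice M G (L w) (fun z g => P w g /\ I (z - f g)).
- by move=> y /LP[g ? ?]; exists g.
- by split; [case: (hP w)|rewrite raddf0 subr0; case: hI].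
exists (kmap g z); split; first exact: kdeg_kmap.
  by apply/kall_kmap; apply: kallW z2 => y /hg[].
rewrite kmap_comp -[X in z - X]scale1r; apply: (kallBf _ z2) => y /hg[_].
by rewrite scale1r.
Qed.

Let sI l := kall_zsub (M:=M) l (lin_pred_zsub hI).

(** The connecting isomorphism of 0 -> Z -> P -> L / I -> 0 for P acyclic.  The cycle z
corresponds to dx where x is a lifting of z to P; acyclicity makes the class of dx
independent of the lifting and the correspondence injective. *)
Lemma step_iso i w : kacyclic P vs ->
  subquo_iso (koszulH hL hI i.+1 w) (syzH hP hZ i (w + 1)).
Proof.
move=> acy; exists (fun z y => exists x,
  [/\ kdeg i.+1 x, kall (P w) x, kall I (z - kmap f x) & kdiff x = y]); split=> /=.
- move=> c z1 z2 y1 y2 [x1 [h1 p1 i1 d1]] [x2 [h2 p2 i2 d2]].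
  exists (c%:MP *: x1 + x2); split; first exact: kdeg_lin.
  + by apply: (lin_pred_kall _ (hP w)).2.
  + rewrite kmap_lin opprD addrACA -scalerBr.
    by apply: (lin_pred_kall _ hI).2.
  by rewrite kdiff_lin d1 d2.
- move=> z [h1 l1 i1]; have [x [hx px ix]] := kall_lift h1 l1.
  exists (kdiff x); last by exists x.
  split; first exact: kdeg_kdiff.
    apply: (@kallW _ _ (fun g => P (w + 1) g /\ I (f g))); first by move=> g /ZE.
    apply/kall_and; split; first exact: kall_kdiffP.
    apply/kall_kmap; rewrite kmap_kdiff -[kmap f x](subKr z) kdiffB.
    exact/(zsubB (sI _))/kall_kdiffI.
  by exists x; rewrite addrK.
- move=> y [hy zy [x [hx]]]; rewrite addrK => px dx; exists (kmap f x); last first.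
    by exists x; split=> //; rewrite subrr; apply: (zsub0 (sI _)).
  split; first by apply: kdeg_kmap => //; rewrite raddf0.
    by apply/kall_kmap; apply: kallW px => g; apply: PL.
  by rewrite -kmap_kdiff dx; apply/kall_kmap; apply: kallW zy => g /ZE[].
move=> z y _ _ [x [hx px ix dx]]; split=> [[l [hl ll il]]|[x' []]].
  have [v [hv pv iv]] := kall_lift hl ll.
  exists (x - kdiff v); rewrite addrK; split.
  - by apply: (zsubB (@kdeg_zsub _ _ _ _)) => //; apply: kdeg_kdiff.
  - apply: (@kallW _ _ (fun g => P w g /\ I (f g))); first by move=> g /ZE.
    apply/kall_and; split.
      apply: (zsubB (kall_zsub _ (lin_pred_zsub (hP _)))) => //.
      by have := kall_kdiffP pv; rewrite subrK.
    apply/kall_kmap; rewrite kmapB kmap_kdiff.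
    have -> : kmap f x - kdiff (kmap f v) = (z - kdiff l) - (z - kmap f x) + kdiff (l - kmap f v).
      by rewrite kdiffB opprB [z - _ + _]addrC !addrA !subrK.
    exact: (zsubD (sI _) (zsubB (sI _) il ix) (kall_kdiffI iv)).
  by rewrite kdiffB kdiffK subr0.
rewrite addrK => hx' zx' dx'.
have [|||v [hv pv dv]] := acy i w (x - x').
- by apply: (zsubB (@kdeg_zsub _ _ _ _)).
- apply: (zsubB (kall_zsub _ (lin_pred_zsub (hP _)))) => //.
  by apply: kallW zx' => g /ZE[].
- by rewrite kdiffB dx dx' subrr.
exists (kmap f v); split; first by apply: kdeg_kmap => //; rewrite raddf0.
  by apply/kall_kmap; apply: kallW pv => g; apply: PL.
rewrite -kmap_kdiff dv kmapB opprB addrA addrAC.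
apply: (zsubD (sI _)) => //; apply/kall_kmap; apply: kallW zx' => g /ZE[] //.
Qed.

End Step.
End Balancing.

Arguments lin_pred_grow {K N r} dg w.
Arguments lin_pred_zhomog {K N} w.

(** * The end of the dimension shifting: passing to constant terms *)

Section KosZero.
Variables (Q : comNzRingType) (M : lmodType Q).

Lemma kmap_kin (M' : lmodType Q) (f : {linear M -> M'}) l z :
  kmap f (kin l z) = kin l (f z).
Proof.
elim: l => [|x l IH] //=; rewrite IH; congr (_, _).
by rewrite -(subrr 0) kmapB subrr.
Qed.

Lemma kall_kinP (N : M -> Prop) l z : N 0 -> kall N (kin l z) <-> N z.
Proof.
move=> N0; split; last exact: kall_kin.
by elim: l => [|x l IH] //= [/IH].
Qed.

End KosZero.

Section Free.
Variables (K : fieldType) (N : nat).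
Local Notation Q := {mpoly K[N]}.
Local Notation vs := (vars K N).

Definition eval0 m n (u : 'M[Q]_(m, n)) : 'M[K]_(m, n) := map_mx (mcoeff 0%MM) u.
Definition cst m n (u : 'M[K]_(m, n)) : 'M[Q]_(m, n) := map_mx (@mpolyC N K) u.

Lemma eval0M m n p (A : 'M[Q]_(m, n)) (B : 'M[Q]_(n, p)) : eval0 (A *m B) = eval0 A *m eval0 B.
Proof. exact: map_mxM. Qed.
Lemma eval0B m n (A B : 'M[Q]_(m, n)) : eval0 (A - B) = eval0 A - eval0 B.
Proof. exact: map_mxB. Qed.
Lemma cstK m n (A : 'M[K]_(m, n)) : eval0 (cst A) = A.
Proof. by apply/matrixP => i j; rewrite !mxE mcoeffC eqxx mulr1. Qed.
Lemma eval0_lin r (c : K) (u v : 'rV[Q]_r) : eval0 (c%:MP *: u + v) = c *: eval0 u + eval0 v.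
Proof. by apply/rowP => k; rewrite !mxE mcoeffD mcoeffCM. Qed.

(** The degree [j] part of the graded space with basis in the degrees [dg]. *)
Definition krow r (dg : 'I_r -> int) (j : int) (v : 'rV[K]_r) : Prop :=
  forall k, dg k != j -> v 0 k = 0.

Lemma krow_eval0 r (dg : 'I_r -> int) j u : grow dg j u -> krow dg j (eval0 u).
Proof.
move=> hu k kj; rewrite mxE; apply: zhomog_coef0 (hu k) _.
by rewrite subr_eq0 eq_sym.
Qed.

Lemma grow_cst r (dg : 'I_r -> int) j v : krow dg j v -> grow dg j (cst v).
Proof.
move=> hv k; rewrite mxE; apply: zhomogC => h; apply: hv.
by rewrite eq_sym -subr_eq0.
Qed.

Section RowMax.
Variables (r : nat) (dg : 'I_r -> int).

(** A homogeneous element of a free module lies in the submodule generated by the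
variables, that is, it is a Koszul boundary, exactly if its constant terms
vanish. *)
Lemma row_max j u : grow dg j u ->
  (eval0 u = 0 <-> exists x : koszul 'rV[Q]_r vs, [/\ kdeg 1 x, kall (grow dg (j - 1)) x & kdiff x = kin vs u]).
Proof.
move=> gu; split=> [u0|[x [_ _ dx]]].
  have h k : exists v, [/\ kdeg 1 v, @kall Q Q^o (zhomog (j - 1 - dg k)) _ v &
      kdiff v = kin vs (rowc k u)].
    have [] := (@lspan_kdiff Q Q^o (@zhomog K N) zhomog_zsub vs (j - dg k) (rowc k u)).1.
      apply/lspan_var_ideal; split; last exact: gu.
      by apply: var_ideal_all; have /rowP/(_ k) := u0; rewrite !mxE.
    by move=> v [h1 h2 h3]; exists v; rewrite addrAC.
  have [v hv] := choice h.
  exists (\sum_k kmap (rowi k) (v k)); split.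
  - apply: (zsub_sum (@kdeg_zsub _ _ _ _)) => k _.
    by apply: kdeg_kmap; [rewrite raddf0|case: (hv k)].
  - apply: (zsub_sum (@kall_grow_zsub _ _ _ _ _ _)) => k _; apply/kall_kmap.
    have [_ + _] := hv k; apply: kallW => z hz i.
    rewrite !mxE eqxx /=; case: eqP => [->|_]; first by rewrite mulr1.
    by rewrite mulr0; apply: zhomog0.
  rewrite [RHS]kmap_rowsum (big_morph _ (kdiffD (l := _)) (kdiff0 _ _)).
  by apply: eq_bigr => k _; rewrite -kmap_kdiff kmap_kin; case: (hv k) => _ _ ->.
have hC : zsub (fun z : 'rV[Q]_r => eval0 z = 0).
  split=> [|y z y0 z0]; first by apply/rowP => k; rewrite !mxE mcoeff0.
  by rewrite eval0B y0 z0 subrr.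
have : kall (fun z : 'rV[Q]_r => eval0 z = 0) (kdiff x).
  apply: (@kall_kdiff _ _ (fun=> True)) => //; last exact: kallT.
  move=> y /mapP[i _ ->] z _; apply/rowP => k.
  by rewrite !mxE rmorphM /= mcoeffX mnm1_eq0 mul0r.
by rewrite dx => /kall_kinP; apply; case: hC.
Qed.

End RowMax.

Section HZero.
Variables (r r' : nat) (dg : 'I_r -> int) (dg' : 'I_r' -> int).
Variables (D : 'M[Q]_(r', r)) (M : lmodType Q).
Variables (L : int -> M -> Prop) (I : M -> Prop) (f : {linear 'rV[Q]_r -> M}).
Hypotheses (hL : forall w, lin_pred (L w)) (hI : lin_pred I).
Hypothesis IX : forall i z, I z -> I ('X_i *: z).
Hypothesis PL : forall w g, grow dg w g -> L w (f g).
Hypothesis LP : forall w z, L w z -> exists2 g, grow dg w g & I (z - f g).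
Hypothesis DG : forall w u', grow dg' w u' -> grow dg w (u' *m D).
Hypothesis EX : forall w u, grow dg w u ->
  (I (f u) <-> exists2 u', grow dg' w u' & u = u' *m D).

Lemma krow_lin j c u v : krow dg j u -> krow dg j v -> krow dg j (c *: u + v).
Proof. by move=> hu hv k kj; rewrite !mxE hu ?hv // mulr0 addr0. Qed.

Definition krow_subquo j : subquo K := @Subquo K 'rV[K]_r *:%R (krow dg j)
  (fun v => exists2 v', krow dg' j v' & v = v' *m eval0 D) (@krow_lin j).

Definition H0rel j (y : koszul M vs) (v : 'rV[K]_r) : Prop :=
  exists q u, [/\ y = kin vs q, grow dg j u, I (q - f u) & v = eval0 u].

Let I0 : I 0. Proof. by case: hI. Qed.
Let sI l := kall_zsub (M:=M) l (lin_pred_zsub hI).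

(** Given a presentation of L / I by [f] and [D], reducing modulo the variables
presents (L / I) (x) K.  The four clauses are those of [subquo_iso], kept apart because
[syzF_base] restricts the isomorphism. *)
Lemma H0_iso j :
  [/\ forall c u v u' v', H0rel j u u' -> H0rel j v v' ->
        H0rel j (c%:MP *: u + v) (c *: u' + v'),
     forall u, @cyc K (koszulH hL hI 0 j) u -> exists2 v, @cyc K (krow_subquo j) v & H0rel j u v,
     forall v, @cyc K (krow_subquo j) v -> exists2 u, @cyc K (koszulH hL hI 0 j) u & H0rel j u v
   & forall u v, @cyc K (koszulH hL hI 0 j) u -> @cyc K (krow_subquo j) v -> H0rel j u v ->
       (@bnd K (koszulH hL hI 0 j) u <-> @bnd K (krow_subquo j) v)].
Proof.
split.
- move=> c _ _ _ _ [q [u [-> gu iu ->]]] [q' [u' [-> gu' iu' ->]]].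
  exists (c%:MP *: q + q'), (c%:MP *: u + u'); split.
  + by rewrite kin_lin.
  + by have [_ h] := @lin_pred_grow K N r dg j; apply: h.
  + by rewrite linearP opprD addrACA -scalerBr; apply: hI.2.
  + by rewrite eval0_lin.
- move=> y [hy ly _]; have [q -> lq] := kinP hy ly.
  have [u gu iu] := LP lq; exists (eval0 u); first exact: krow_eval0.
  by exists q, u.
- move=> v kv; exists (kin vs (f (cst v))); last first.
    exists (f (cst v)), (cst v); rewrite subrr cstK; split=> //.
    exact: grow_cst.
  split; first exact: kdeg_kin.
    by apply: kall_kin; [case: (hL j)|apply/PL/grow_cst].
  by rewrite kdeg_kdiff0; [apply: (zsub0 (sI _))|apply: kdeg_kin].
move=> _ _ _ _ [q [u [-> gu iu ->]]]; split=> [[z [hz lz iz]]|[v' kv' def_v]].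
  have [x [hx px ix]] := kall_lift (lin_pred_grow dg) hI LP hz lz.
  have dpx : kall (grow dg j) (kdiff x) by have := kall_grow_kdiff px; rewrite subrK.
  have [g dx gg] := kinP (kdeg_kdiff hx) dpx.
  have ig : I (f (u - g)).
    have : I ((q - f g) - (q - f u)).
      apply: (zsubB (lin_pred_zsub hI)) => //.
      apply/(kall_kinP vs (q - f g) I0); rewrite kinB -kmap_kin -dx kmap_kdiff.
      rewrite -[kin vs q](subrK (kdiff z)) -addrA -kdiffB.
      apply: (zsubD (sI _)) => //.
      exact: kall_kdiffI.
    by rewrite opprB addrC addrA subrK [f (u - g)]linearB.
  have gug : grow dg j (u - g) by apply: (zsubB (grow_zsub dg j)).
  have [u' gu' e] := (EX gug).1 ig.
  exists (eval0 u'); first exact: krow_eval0.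
  rewrite -eval0M -e eval0B [eval0 g](_ : _ = 0) ?subr0 //.
  by apply/(row_max gg); exists x.
have gc := grow_cst kv'; have guD := DG gc.
have gd : grow dg j (u - cst v' *m D) by apply: (zsubB (grow_zsub dg j)).
have [|x [hx px dx]] := (row_max gd).1; first by rewrite eval0B eval0M cstK def_v subrr.
exists (kmap f x); split.
- by apply: kdeg_kmap => //; rewrite raddf0.
- by apply/kall_kmap; apply: kallW px => g; apply: PL.
rewrite -kmap_kdiff dx kmap_kin -kinB; apply/kall_kinP => //.
rewrite [f (_ - _)]linearB opprB addrA addrAC; apply: (zsubD (lin_pred_zsub hI)) => //.
by apply/(EX guD); exists (cst v').
Qed.

End HZero.
End Free.

(** * Tor from a resolution and from the Koszul complex *)

Section Resolution.
Variables (K : fieldType) (N : nat).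
Local Notation Q := {mpoly K[N]}.
Local Notation vs := (vars K N).

Definition rowpart r (dg : 'I_r -> int) w (u : 'rV[Q]_r) : 'rV[Q]_r :=
  \row_k zpart (w - dg k) (u 0 k).

Lemma rowpart_grow r (dg : 'I_r -> int) w u : grow dg w (rowpart dg w u).
Proof. by move=> k; rewrite mxE; apply: zpart_homog. Qed.

Lemma rowpart_id r (dg : 'I_r -> int) w u : grow dg w u -> rowpart dg w u = u.
Proof. by move=> h; apply/rowP => k; rewrite mxE zpart_id. Qed.

Section Mul.
Variables (r' r : nat) (dg' : 'I_r' -> int) (dg : 'I_r -> int) (D : 'M[Q]_(r', r)).
Hypothesis hD : forall k l, zhomog (dg' k - dg l) (D k l).

Lemma rowpartM w u : rowpart dg w (u *m D) = rowpart dg' w u *m D.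
Proof.
apply/rowP => l; rewrite !mxE zpart_sum; apply: eq_bigr => k _.
rewrite mxE -(zpartM _ _ (hD k l)); congr (zpart _ _).
by rewrite addrA subrK.
Qed.

Lemma growM w u : grow dg' w u -> grow dg w (u *m D).
Proof. by move=> /rowpart_id <-; rewrite -rowpartM; apply: rowpart_grow. Qed.

(** Exactness of a resolution holds degree by degree. *)
Lemma grow_imP w u : grow dg w u -> (exists w', u = w' *m D) ->
  exists2 u', grow dg' w u' & u = u' *m D.
Proof.
move=> gu [x e]; exists (rowpart dg' w x); first exact: rowpart_grow.
by rewrite -rowpartM -e rowpart_id.
Qed.
End Mul.

Definition row_comb r (c : 'I_r -> Q) (u : 'rV[Q]_r) : Q^o := \sum_k u 0 k * c k.
Fact row_comb_linear r c : linear (@row_comb r c).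
Proof.
move=> a u v; rewrite /row_comb scaler_sumr -big_split; apply: eq_bigr => k _ /=.
by rewrite !mxE mulrDl -mulrA.
Qed.
HB.instance Definition _ r c := GRing.isLinear.Build Q 'rV[Q]_r Q^o *:%R
  (@row_comb r c) (@row_comb_linear r c).

Variables (M : lmodType Q) (gr : int -> M -> Prop) (F : gfree_resolution gr).

Lemma tens_degP i j v : v \in tens_deg F i j <-> krow (@fr_deg _ _ _ _ F i) j v.
Proof.
split=> [|hv].
  rewrite /tens_deg; set X := [seq _ | _ <- _ & _] => hv k kj.
  rewrite (coord_span (X := in_tuple X) hv) summxE big1 // => l _.
  rewrite mxE.
  have /mapP[k' + ->] : X`_l \in X by apply: mem_nth; exact: ltn_ord.
  rewrite mem_filter => /andP[/eqP dk' _]; rewrite mxE eqxx /=.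
  by case: eqP => [e|_]; [rewrite e dk' eqxx in kj|rewrite mulr0].
rewrite [v]row_sum_delta; apply: memv_suml => k _.
have [kj|kj] := eqVneq (fr_deg k) j; last by rewrite hv // scale0r mem0v.
apply/memvZ/memv_span/mapP; exists k => //.
by rewrite mem_filter kj eqxx mem_enum.
Qed.

Lemma tens_diffE i v : tens_diff F i v = v *m eval0 (fr_diff F i).
Proof. by rewrite lfunE. Qed.

Lemma tor_boundsP i j v : v \in tor_bounds F i j <->
  exists2 v', krow (@fr_deg _ _ _ _ F i.+1) j v' & v = v' *m eval0 (fr_diff F i).
Proof.
split=> [/memv_imgP[v' /tens_degP h ->]|[v' h ->]].
  by exists v' => //; rewrite tens_diffE.
by apply/memv_imgP; exists v'; [apply/tens_degP|rewrite tens_diffE].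
Qed.

Lemma tor_subquo_lin i j (c : K) (u v : 'rV[K]_(fr_rank F i)) :
  u \in tor_cycles F i j -> v \in tor_cycles F i j -> c *: u + v \in tor_cycles F i j.
Proof. by move=> hu hv; rewrite memvD ?memvZ. Qed.

Definition tor_subquo i j : subquo K := @Subquo K 'rV[K]_(fr_rank F i) *:%R
  (fun v => v \in tor_cycles F i j) (fun v => v \in tor_bounds F i j)
  (@tor_subquo_lin i j).

Lemma tor_subquo_tor i j : subquo_iso (tor_subquo i j) (subquo_vs (tor F i j)).
Proof.
pose U := (linfun (vsval : subvs_of (tor_cycles F i j) -> _) @^-1: tor_bounds F i j)%VS.
exists (fun v t => exists2 c : subvs_of (tor_cycles F i j), vsval c = v & t = vquot_pi U c).
split=> /=.
- move=> c u v _ _ [x <- ->] [y <- ->]; exists (c *: x + y); first by rewrite linearP.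
  by rewrite linearP.
- by move=> v hv; exists (vquot_pi U (Subvs hv)) => //; exists (Subvs hv).
- move=> t _; exists (vsval (repr t)); first exact: subvsP.
  by exists (repr t); rewrite ?vquot_piK.
move=> v t _ _ [c <- ->].
have -> : vquot_pi U c = 0 <-> c \in U.
  rewrite -(linear0 (vquot_pi U)); split=> [/eqP|h]; last apply/eqP; rewrite vquot_pi_eq subr0 //.
by rewrite /U -memv_preim lfunE.
Qed.

Local Notation grF i := (grow (@fr_deg _ _ _ _ F i)).
Local Notation D i := (fr_diff F i).

(** The image of the differential [D i], the kernel of the map before it. *)
Definition syz i w (u : 'rV[Q]_(fr_rank F i)) : Prop :=
  grF i w u /\ exists x, u = x *m D i.

Lemma lin_pred_syz i w : lin_pred (syz (i:=i) w).
Proof.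
split=> [|c u v [gu [x eu]] [gv [y ev]]].
  split; first exact: (zsub0 (grow_zsub _ _)).
  by exists 0; rewrite mul0mx.
split; first by have [_ h] := @lin_pred_grow K N _ (@fr_deg _ _ _ _ F i) w; apply: h.
by exists (c%:MP *: x + y); rewrite eu ev mulmxDl scalemxAl.
Qed.

Definition syzF i j w : subquo K := syzH (@lin_pred_grow K N _ (@fr_deg _ _ _ _ F i)) (@lin_pred_syz i) j w.

Lemma fr_diff_comp i (x : 'rV[Q]_(fr_rank F i.+2)) : x *m D i.+1 *m D i = 0.
Proof. by apply/fr_exactS; exists x. Qed.

Lemma syzF_step p i w : subquo_iso (syzF p i.+1 w) (syzF p.+1 i (w + 1)).
Proof.
apply: (@subquo_iso_trans K (koszulH (@lin_pred_syz p) (@lin_pred_eq0 K N _) i.+1 w)).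
  by apply: syzH_koszulH; [move=> v z []|apply: kacyclic_row].
apply: (step_iso (f := mulmxr (D p))).
- by move=> j z ->; rewrite scaler0.
- by move=> j v z; apply: grow_mulX.
- by move=> v g; split=> -[gg h]; split=> //; apply/fr_exactS.
- move=> v g gg; split; last by exists g.
  exact: (growM (fr_diff_homog (g:=F) (i:=p))).
- move=> v z [gz hz]; have [u gu ->] := grow_imP (fr_diff_homog (g:=F) (i:=p)) gz hz.
  by exists u; rewrite //= subrr.
exact: kacyclic_row.
Qed.

(** The kernel of Z (x) K -> F_p (x) K, for Z the image of F_(p+1) in F_p, is the homology of
F (x) K at p + 1: on constant terms, the map to F_p (x) K is the reduced
differential. *)
Lemma syzF_base p w : subquo_iso (syzF p 0 w) (tor_subquo p.+1 w).
Proof.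
pose f : {linear 'rV[Q]_(fr_rank F p.+1) -> 'rV[Q]_(fr_rank F p)} := mulmxr (D p).
have PL v g : grF p.+1 v g -> syz v (f g).
  move=> gg; split; last by exists g.
  exact: (growM (fr_diff_homog (g:=F) (i:=p))).
have LP v (z : 'rV_(fr_rank F p)) : syz v z -> exists2 g, grF p.+1 v g & z - f g = 0.
  move=> [gz hz]; have [u gu ->] := grow_imP (fr_diff_homog (g:=F) (i:=p)) gz hz.
  by exists u; rewrite //= subrr.
have EX v u : grF p.+1 v u ->
    f u = 0 <-> (exists2 u', grF p.+2 v u' & u = u' *m D p.+1).
  move=> gu; split=> [|[u' _ ->]]; last exact: fr_diff_comp.
  by move/fr_exactS; apply: (grow_imP (fr_diff_homog (g:=F) (i:=p.+1))).
have DG v u' : grF p.+2 v u' -> grF p.+1 v (u' *m D p.+1).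
  exact: (growM (fr_diff_homog (g:=F) (i:=p.+1))).
have IX (j : 'I_N) (z : 'rV[Q]_(fr_rank F p)) : z = 0 -> 'X_j *: z = 0.
  by move=> ->; rewrite scaler0.
have H := H0_iso (@lin_pred_syz p) (@lin_pred_eq0 K N _) IX PL LP DG EX w.
pose C (y : koszul 'rV[Q]_(fr_rank F p) vs) :=
  exists x, [/\ kdeg 1 x, kall (grF p (w - 1)) x & kdiff x = y].
pose C' (v : 'rV[K]_(fr_rank F p.+1)) := v *m eval0 (D p) = 0.
have CC y v : H0rel (@fr_deg _ _ _ _ F p.+1) (fun z => z = 0) f w y v -> C y <-> C' v.
  move=> [q [u [-> gu e ->]]]; rewrite /C' -eval0M.
  have -> : q = u *m D p by apply/eqP; rewrite -subr_eq0; apply/eqP.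
  by apply: iff_sym; apply: row_max; apply: (growM (fr_diff_homog (g:=F) (i:=p))).
have TC y : syzH_cyc (grF p) (@syz p) 0 w y <->
    koszulH_cyc (@syz p) (fun z => z = 0) 0 w y /\ C y.
  split=> [[h1 h2 h3]|[[h1 h2 _] h3]]; split=> //; split=> //.
  by rewrite kdeg_kdiff0 //; apply/kall0.
have hC c u v : koszulH_cyc (@syz p) (fun z => z = 0) 0 w u /\ C u ->
    koszulH_cyc (@syz p) (fun z => z = 0) 0 w v /\ C v ->
    koszulH_cyc (@syz p) (fun z => z = 0) 0 w (c%:MP *: u + v) /\ C (c%:MP *: u + v).
  move=> /TC hu /TC hv; apply/TC; apply: syzH_cyc_lin hu hv.
    exact: lin_pred_grow.
  exact: lin_pred_syz.
have hC' (c : K) u v : krow (@fr_deg _ _ _ _ F p.+1) w u /\ C' u ->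
    krow (@fr_deg _ _ _ _ F p.+1) w v /\ C' v ->
    krow (@fr_deg _ _ _ _ F p.+1) w (c *: u + v) /\ C' (c *: u + v).
  move=> [ku Cu] [kv Cv]; split; first exact: krow_lin.
  by rewrite /C' mulmxDl -scalemxAl Cu Cv scaler0 addr0.
pose X := koszulH (@lin_pred_syz p) (@lin_pred_eq0 K N _) 0 w.
pose Y := krow_subquo (@fr_deg _ _ _ _ F p.+1) (@fr_deg _ _ _ _ F p.+2) (D p.+1) w.
have H' := @subquo_iso_cut K X C hC Y C' hC' _ H (fun u v _ _ => CC u v).
apply: subquo_iso_trans (subquo_iso_trans H' _).
  apply: subquo_iso_id => [u|u _]; first exact: TC.
  split=> [[x [x1 x2 x3]]|[x [x1 x2 x3]]]; exists x; split=> //.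
    by rewrite x3 subrr; apply/kall0.
  by apply/esym/eqP; rewrite -subr_eq0; apply/eqP/kall0.
apply: subquo_iso_id => [u|u _]; last by rewrite tor_boundsP.
rewrite /tor_cycles memv_cap memv_ker tens_diffE.
by split=> [[/tens_degP-> /eqP]|/andP[/tens_degP ? /eqP]].
Qed.

Lemma syzF_tor i p w : subquo_iso (syzF p i w) (tor_subquo (p + i).+1 (i%:Z + w)).
Proof.
elim: i p w => [|i IH] p w; first by rewrite addn0 add0r; apply: syzF_base.
apply: subquo_iso_trans (syzF_step _ _ _) _.
have -> : i.+1%:Z + w = i%:Z + (w + 1) by lia.
by rewrite addnS -addSn; apply: IH.
Qed.

Variable e : Q -> M.
Hypotheses (eB : forall p q, e (p - q) = e p - e q) (eM : forall p q, e (p * q) = p *: e q).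
Hypothesis gr_e : forall d u, gr d u -> exists2 q, zhomog d q & u = e q.
Hypothesis ker_e : forall d q, e q = 0 -> e (zpart d q) = 0.

Definition ker_pred (q : Q^o) : Prop := e q = 0.

Lemma e0 : e 0 = 0. Proof. by rewrite -(subrr 0) eB subrr. Qed.
Lemma eD p q : e (p + q) = e p + e q.
Proof. by rewrite -[q in LHS]opprK eB -sub0r eB e0 sub0r opprK. Qed.

Lemma lin_pred_ker_pred : lin_pred ker_pred.
Proof.
split=> [|c u v eu ev]; first exact: e0.
by rewrite /ker_pred eD ev addr0 -[_ *: _]/(c%:MP * u) eM eu scaler0.
Qed.

(** The map e : Q -> M makes M the cyclic module Q / ker e.  The kernel being
homogeneous, liftings to F_0 can be chosen homogeneous, which starts the
dimension shifting; it ends with [syzF_base]. *)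
Theorem balancing i w :
  subquo_iso (koszulH lin_pred_zhomog lin_pred_ker_pred i w) (subquo_vs (tor F i (i%:Z + w))).
Proof.
have [c hc] : exists c : 'I_(fr_rank F 0) -> Q, forall k,
    zhomog (fr_deg k) (c k) /\ fr_aug F (delta_mx 0 k) = e (c k).
  have [k|c hc] := @choice _ _ (fun k q => zhomog (fr_deg k) q /\ fr_aug F (delta_mx 0 k) = e q).
    by have [q ? ?] := gr_e (fr_aug_homog (g:=F) k); exists q.
  by exists c.
pose f : {linear 'rV[Q]_(fr_rank F 0) -> Q^o} := row_comb c.
have ef u : e (f u) = fr_aug F u.
  rewrite /= /row_comb {2}[u]row_sum_delta raddf_sum (big_morph _ eD e0).
  apply: eq_bigr => k _; rewrite eM -(hc k).2.
  exact: (esym (linearZ_LR (fr_aug F) (u 0 k) (delta_mx 0 k))).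
have PL v g : grF 0 v g -> @zhomog K N v (f g).
  move=> gg; apply: (zsub_sum (zhomog_zsub _)) => k _.
  by have := zhomogM (gg k) (hc k).1; rewrite subrK.
have zf v u : zpart v (f u) = f (rowpart (@fr_deg _ _ _ _ F 0) v u).
  rewrite /= /row_comb zpart_sum; apply: eq_bigr => k _.
  by rewrite mxE -(zpartM _ _ (hc k).1) subrK.
have LP v z : @zhomog K N v z -> exists2 g, grF 0 v g & ker_pred (z - f g).
  move=> hz; have [u hu] := fr_aug_surj F (e z).
  exists (rowpart (@fr_deg _ _ _ _ F 0) v u); first exact: rowpart_grow.
  rewrite /ker_pred -zf -{1}(zpart_id hz) -zpartB; apply: ker_e.
  by rewrite eB ef hu subrr.
have IX (j : 'I_N) (z : Q^o) : ker_pred z -> ker_pred ('X_j *: z).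
  by rewrite /ker_pred -[_ *: _]/('X_j * z) eM => ->; rewrite scaler0.
have EX v u : grF 0 v u ->
    ker_pred (f u) <-> (exists2 u', grF 1 v u' & u = u' *m D 0).
  move=> gu; rewrite /ker_pred ef; split=> [/fr_exact0|[u' _ ->]].
    exact: (grow_imP (fr_diff_homog (g:=F) (i:=0))).
  by apply/fr_exact0; exists u'.
have DG v u' : grF 1 v u' -> grF 0 v (u' *m D 0).
  exact: (growM (fr_diff_homog (g:=F) (i:=0))).
apply: subquo_iso_trans (tor_subquo_tor _ _).
case: i => [|i].
  rewrite add0r.
  have H := H0_iso (M := Q^o) (L := @zhomog K N) lin_pred_zhomog lin_pred_ker_pred IX PL LP DG EX w.
  apply: (@subquo_iso_trans K (krow_subquo (@fr_deg _ _ _ _ F 0) (@fr_deg _ _ _ _ F 1) (D 0) w)).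
    by eexists; exact: H.
  by apply: subquo_iso_id => [u|u _]; [rewrite tens_degP|rewrite tor_boundsP].
have -> : i.+1%:Z + w = i%:Z + (w + 1) by lia.
apply: subquo_iso_trans (syzF_tor i 0 (w + 1)).
apply: (step_iso (M := Q^o) (L := @zhomog K N) (f := f)) => //.
- by move=> j v z; apply: grow_mulX.
- move=> v g; split=> -[gg h]; split=> //.
    by rewrite /ker_pred ef; apply/fr_exact0.
  by have [x _ ->] := (EX v g gg).1 h; exists x.
- exact: kacyclic_row.
Qed.

End Resolution.

(** * Retractions of polynomial rings onto subsets of the variables *)

Section Retract.
Variables (K : fieldType).

Lemma mpoly_ext N (R : comNzRingType) (f g : {rmorphism {mpoly K[N]} -> R}) :
  (forall c, f c%:MP = g c%:MP) -> (forall i, f 'X_i = g 'X_i) -> f =1 g.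
Proof.
move=> hc hx; elim/mpolyind => [|c k p _ _ IH]; first by rewrite !rmorph0.
rewrite !rmorphD IH -mul_mpolyC !rmorphM hc; congr (_ * _ + _).
rewrite mpolyXE_id !rmorph_prod; apply: eq_bigr => i _.
by rewrite !rmorphXn hx.
Qed.

Lemma var_eq0 N (i : 'I_N) : ('X_i == 0 :> {mpoly K[N]}) = false.
Proof.
apply/eqP => /(congr1 (mcoeff U_(i))); rewrite mcoeffX eqxx mcoeff0 => /eqP.
by rewrite oner_eq0.
Qed.

Section Comp.
Variables (N N' : nat) (t : N.-tuple {mpoly K[N']}).
Hypothesis ht : forall i, zhomog 1 (tnth t i).

Lemma comp_homX k : zhomog (Posz (mdeg k)) ('X_[k] \mPo t).
Proof.
rewrite comp_mpolyX mdegE; elim/big_rec2: _ => [|i y1 y2 _ IH].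
  by rewrite /= dhomog1.
rewrite PoszD; apply: zhomogM => //.
elim: (k i) => [|e IHe]; first by rewrite /= dhomog1.
by rewrite exprS -add1n PoszD; apply: zhomogM.
Qed.

Lemma comp_zpart d p : (zpart d p) \mPo t = zpart d (p \mPo t).
Proof.
elim/mpolyind: p => [|c k p _ _ IH]; first by rewrite !comp_mpoly0 !zpart0 comp_mpoly0.
rewrite zpart_lin !comp_mpolyD !comp_mpolyZ zpart_lin IH; congr (_ *: _ + _).
have [e|ne] := eqVneq (Posz (mdeg k)) d.
  by rewrite -e !zpart_id //; [apply: comp_homX|apply: zhomogX].
rewrite (zpart_ne (comp_homX k) ne) (zpart_ne (zhomogX _ k) ne).
exact: comp_mpoly0.
Qed.

Lemma comp_zhomog d p : zhomog d p -> zhomog d (p \mPo t).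
Proof. by move=> /zpart_id <-; rewrite comp_zpart; apply: zpart_homog. Qed.

(** The tuple [s] brings back the variables that [t] does not kill. *)
Variable s : N'.-tuple {mpoly K[N]}.
Hypothesis hs : forall i, tnth t i = 0 \/ (tnth t i) \mPo s = 'X_i.

Definition killed : seq 'I_N := [seq i <- enum 'I_N | tnth t i == 0].

(** When [t] kills some variables and [s] brings the others back, a polynomial and its
retract agree up to the killed variables. *)
Lemma comp_var_ideal p : var_ideal killed (p - ((p \mPo t) \mPo s)).
Proof.
elim/mpolyind: p => [|c k p _ _ IH].
  by rewrite !comp_mpoly0 subr0; apply: (zsub0 (var_ideal_zsub _)).
rewrite !comp_mpolyD !comp_mpolyZ opprD addrACA -scalerBr.
apply: (zsubD (var_ideal_zsub _)) => //; apply: var_idealZ => {c p IH}.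
case: (pickP (fun i => (tnth t i == 0) && (k i != 0%N))) => [i /andP[ti ki]|h].
  rewrite comp_mpolyX (bigD1 i) //= (eqP ti) expr0n (negPf ki) mul0r comp_mpoly0 subr0.
  move=> k'; rewrite mcoeffX; case: (k =P k') => [<- _|_]; last by rewrite eqxx.
  by exists i => //; rewrite mem_filter ti mem_enum.
rewrite comp_mpolyX rmorph_prod /= {1}mpolyXE_id.
rewrite [X in var_ideal _ X](_ : _ = 0); first exact: (zsub0 (var_ideal_zsub _)).
apply/eqP; rewrite subr_eq0; apply/eqP; apply: eq_bigr => i _.
rewrite rmorphXn /=; have [ti|-> //] := hs i.
by have := h i; rewrite /= ti eqxx /= => /negbFE/eqP->.
Qed.

Lemma var_ideal_comp p : var_ideal killed p <-> p \mPo t = 0.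
Proof.
split=> [h|h]; last by have := @comp_var_ideal p; rewrite h comp_mpoly0 subr0.
rewrite [p]mpolyE raddf_sum big1_seq //= => k.
rewrite mcoeff_msupp => /h[i]; rewrite mem_filter => /andP[/eqP ti _] ki.
rewrite comp_mpolyZ comp_mpolyX (bigD1 i) //= ti expr0n (negPf ki) mul0r.
by rewrite scaler0.
Qed.

End Comp.

Lemma var_idealP N (I : finType) (v : I -> 'I_N) (p : {mpoly K[N]}) :
  var_ideal [seq v i | i : I] p <->
  exists c : I -> {mpoly K[N]}, p = \sum_i c i * 'X_(v i).
Proof.
split=> [h|[c ->]]; last first.
  apply: (zsub_sum (var_ideal_zsub _)) => i _; apply/var_idealM/var_idealX.
  by apply/mapP; exists i; rewrite ?mem_enum.
rewrite [p]mpolyE big_seq; elim/big_ind: _.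
- by exists (fun=> 0); rewrite big1 // => i _; rewrite mul0r.
- move=> _ _ [c ->] [d ->]; exists (fun i => c i + d i).
  by rewrite -big_split; apply: eq_bigr => i _; rewrite mulrDl.
move=> k; rewrite mcoeff_msupp => /h[_ /mapP[i _ ->] ki].
exists (fun j => if j == i then p@_k *: 'X_[k - U_(v i)] else 0).
rewrite (bigD1 i) //= eqxx big1 ?addr0 => [|j /negPf->]; last by rewrite mul0r.
by rewrite -scalerAl -mpolyXD submK // lep1mP.
Qed.

End Retract.

(** * The rings R and S inside Q *)

Section FromRS.
Variables (K : fieldType) (m n : nat).
Local Notation R := {mpoly K[m]}.
Local Notation S := {mpoly K[n]}.
Local Notation Q := {mpoly K[m + n]}.

Let tR : (m + n).-tuple R := [tuple if split i is inl k then 'X_k else 0 | i < m + n].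
Let tS : (m + n).-tuple S := [tuple if split i is inr k then 'X_k else 0 | i < m + n].
Let sR : m.-tuple Q := [tuple 'X_(lshift n i) | i < m].
Let sS : n.-tuple Q := [tuple 'X_(rshift m i) | i < n].

Definition from_R : R -> Q := comp_mpoly sR.
Definition from_S : S -> Q := comp_mpoly sS.
HB.instance Definition _ := GRing.RMorphism.on from_R.
HB.instance Definition _ := GRing.RMorphism.on from_S.

Lemma tR_hom i : zhomog 1 (tnth tR i).
Proof. by rewrite tnth_mktuple; case: (split i) => k; [apply: zhomog_X1|apply: zhomog0]. Qed.
Lemma tS_hom i : zhomog 1 (tnth tS i).
Proof. by rewrite tnth_mktuple; case: (split i) => k; [apply: zhomog0|apply: zhomog_X1]. Qed.
Lemma sR_hom i : zhomog 1 (tnth sR i).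
Proof. by rewrite tnth_mktuple; apply: zhomog_X1. Qed.
Lemma sS_hom i : zhomog 1 (tnth sS i).
Proof. by rewrite tnth_mktuple; apply: zhomog_X1. Qed.

Lemma to_R_zhomog d q : zhomog d q -> zhomog d (@to_R K m n q).
Proof. exact: comp_zhomog tR_hom _ _. Qed.
Lemma to_S_zhomog d q : zhomog d q -> zhomog d (@to_S K m n q).
Proof. exact: comp_zhomog tS_hom _ _. Qed.
Lemma from_R_zhomog d p : zhomog d p -> zhomog d (from_R p).
Proof. exact: comp_zhomog sR_hom _ _. Qed.
Lemma from_S_zhomog d p : zhomog d p -> zhomog d (from_S p).
Proof. exact: comp_zhomog sS_hom _ _. Qed.
Lemma to_R_zpart d q : @to_R K m n (zpart d q) = zpart d (to_R q).
Proof. exact: comp_zpart tR_hom _ _. Qed.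
Lemma to_S_zpart d q : @to_S K m n (zpart d q) = zpart d (to_S q).
Proof. exact: comp_zpart tS_hom _ _. Qed.

Lemma split_l (i : 'I_m) : split (lshift n i) = inl i.
Proof. by rewrite -[lshift n i]/(unsplit (inl i)) unsplitK. Qed.
Lemma split_r (i : 'I_n) : split (rshift m i) = inr i.
Proof. by rewrite -[rshift m i]/(unsplit (inr i)) unsplitK. Qed.

Lemma to_R_x i : @to_R K m n 'X_(lshift n i) = 'X_i.
Proof. by rewrite /to_R comp_mpolyXU -tnth_nth tnth_mktuple split_l. Qed.
Lemma to_R_y i : @to_R K m n 'X_(rshift m i) = 0.
Proof. by rewrite /to_R comp_mpolyXU -tnth_nth tnth_mktuple split_r. Qed.
Lemma to_S_x i : @to_S K m n 'X_(lshift n i) = 0.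
Proof. by rewrite /to_S comp_mpolyXU -tnth_nth tnth_mktuple split_l. Qed.
Lemma to_S_y i : @to_S K m n 'X_(rshift m i) = 'X_i.
Proof. by rewrite /to_S comp_mpolyXU -tnth_nth tnth_mktuple split_r. Qed.
Lemma from_R_X i : from_R 'X_i = 'X_(lshift n i).
Proof. by rewrite /from_R comp_mpolyXU -tnth_nth tnth_mktuple. Qed.
Lemma from_S_X i : from_S 'X_i = 'X_(rshift m i).
Proof. by rewrite /from_S comp_mpolyXU -tnth_nth tnth_mktuple. Qed.

Lemma from_RK p : to_R (from_R p) = p.
Proof.
apply: (mpoly_ext (f := @to_R K m n \o from_R) (g := idfun)) => [c|i] /=.
  by rewrite /to_R /from_R !comp_mpolyC.
by rewrite from_R_X to_R_x.
Qed.
Lemma from_SK p : to_S (from_S p) = p.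
Proof.
apply: (mpoly_ext (f := @to_S K m n \o from_S) (g := idfun)) => [c|i] /=.
  by rewrite /to_S /from_S !comp_mpolyC.
by rewrite from_S_X to_S_y.
Qed.
Lemma to_S_from_R p : to_S (from_R p) = (p@_0%MM)%:MP.
Proof.
apply: (mpoly_ext (f := @to_S K m n \o from_R) (g := @mpolyC n K \o mcoeff 0%MM)) => [c|i] /=.
  by rewrite /to_S /from_R !comp_mpolyC mcoeffC eqxx mulr1.
by rewrite from_R_X to_S_x mcoeffX mnm1_eq0.
Qed.
Lemma to_R_from_S p : to_R (from_S p) = (p@_0%MM)%:MP.
Proof.
apply: (mpoly_ext (f := @to_R K m n \o from_S) (g := @mpolyC m K \o mcoeff 0%MM)) => [c|i] /=.
  by rewrite /to_R /from_S !comp_mpolyC mcoeffC eqxx mulr1.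
by rewrite from_S_X to_R_y mcoeffX mnm1_eq0.
Qed.

Definition xvars : seq 'I_(m + n) := [seq lshift n i | i : 'I_m].
Definition yvars : seq 'I_(m + n) := [seq rshift m i | i : 'I_n].

Lemma killed_R : killed tR =i yvars.
Proof.
move=> i; rewrite mem_filter mem_enum andbT tnth_mktuple.
have := splitK i; case: (split i) => k <- /=.
  rewrite var_eq0; apply/esym/negbTE/negP => /mapP[j _ /eqP].
  by rewrite eq_lrshift.
by rewrite eqxx; apply/esym/map_f; rewrite mem_enum.
Qed.

Lemma killed_S : killed tS =i xvars.
Proof.
move=> i; rewrite mem_filter mem_enum andbT tnth_mktuple.
have := splitK i; case: (split i) => k <- /=.
  by rewrite eqxx; apply/esym/map_f; rewrite mem_enum.
rewrite var_eq0; apply/esym/negbTE/negP => /mapP[j _ /eqP].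
by rewrite eq_rlshift.
Qed.

Lemma ker_to_R (q : Q) : var_ideal yvars q <-> to_R q = 0.
Proof.
have hs i : tnth tR i = 0 \/ (tnth tR i) \mPo sR = 'X_i.
  rewrite tnth_mktuple; have := splitK i; case: (split i) => k <- /=; last by left.
  by right; exact: from_R_X.
rewrite -(var_ideal_comp hs); split; apply: var_idealW => i; by rewrite killed_R.
Qed.

Lemma ker_to_S (q : Q) : var_ideal xvars q <-> to_S q = 0.
Proof.
have hs i : tnth tS i = 0 \/ (tnth tS i) \mPo sS = 'X_i.
  rewrite tnth_mktuple; have := splitK i; case: (split i) => k <- /=; first by left.
  by right; exact: from_S_X.
rewrite -(var_ideal_comp hs); split; apply: var_idealW => i; by rewrite killed_S.
Qed.

Lemma xvars_uniq : uniq xvars.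
Proof. by rewrite map_inj_uniq ?enum_uniq //; apply: lshift_inj. Qed.
Lemma yvars_uniq : uniq yvars.
Proof. by rewrite map_inj_uniq ?enum_uniq //; apply: rshift_inj. Qed.

(** A monomial of x \cap y involves both an x and a y, hence has degree at least 2. *)
Lemma ker_to_RS1 (q : Q) : zhomog 1 q -> to_R q = 0 -> to_S q = 0 -> q = 0.
Proof.
move=> /zhomogE h1 /ker_to_R hy /ker_to_S hx; apply/mpolyP => k.
rewrite mcoeff0; apply/eqP/negPn/negP => qk.
have [_ /mapP[i _ ->] ki] := hx k qk; have [_ /mapP[j _ ->] kj] := hy k qk.
have [dk] := h1 k qk; move: dk; rewrite mdegE (bigD1 (lshift n i)) //=.
rewrite (bigD1 (rshift m j)) ?eq_rlshift //=.
by move: ki kj; case: (k _) => // a _; case: (k _) => // b _; lia.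
Qed.

Lemma ideal_xyP (q : Q) : q \in @ideal_xy K m n <-> to_R q = 0 /\ to_S q = 0.
Proof.
rewrite -ker_to_R -ker_to_S !var_idealP inE.
by split=> [/andP[/asboolP hx /asboolP hy]|[hy hx]]; [split|apply/andP; split; apply/asboolP].
Qed.

End FromRS.

(** * Koszul homology modulo an intersection of ideals *)

Section MayerVietoris.
Variables (K : fieldType) (N : nat).
Local Notation Q := {mpoly K[N]}.
Local Notation vs := (vars K N).
Local Notation kQ := (koszul Q^o vs).
Local Notation kallQ P := (@kall Q Q^o P vs).
Local Notation hom := (@zhomog K N).
Local Notation bndQ := (@koszulH_bnd K N Q^o (@zhomog K N)).
Local Notation cycQ := (@koszulH_cyc K N Q^o (@zhomog K N)).

Lemma koszulH_neg (I : Q^o -> Prop) (hI : lin_pred I) i w u : w < 0 ->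
  @cyc K (koszulH lin_pred_zhomog hI i w) u -> @bnd K (koszulH lin_pred_zhomog hI i w) u.
Proof.
move=> w0 [_ zu _].
have -> : u = 0 by apply/kall0; apply: kallW zu => z; apply: zhomog_neg.
exists 0; split; first exact: kdeg0.
  exact: (zsub0 (kallQ_zhomog _ _)).
by rewrite kdiff0 subrr; apply: (zsub0 (kall_zsub vs (lin_pred_zsub hI))).
Qed.

Lemma koszulH_big (I : Q^o -> Prop) (hI : lin_pred I) i w u : (N < i)%N ->
  @cyc K (koszulH lin_pred_zhomog hI i w) u -> @bnd K (koszulH lin_pred_zhomog hI i w) u.
Proof.
move=> Ni [hu _ _].
have -> : u = 0 by apply: kdeg_big hu; rewrite size_map size_enum_ord.
exists 0; split; first exact: kdeg0.
  exact: (zsub0 (kallQ_zhomog _ _)).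
by rewrite kdiff0 subrr; apply: (zsub0 (kall_zsub vs (lin_pred_zsub hI))).
Qed.

(** A cyclic module is generated in degree 0. *)
Lemma koszulH_zero (I : Q^o -> Prop) (hI : lin_pred I) w u : w != 0 ->
  @cyc K (koszulH lin_pred_zhomog hI 0 w) u -> @bnd K (koszulH lin_pred_zhomog hI 0 w) u.
Proof.
case: (ltrgtP w 0) => // w0 _ cu; first exact: koszulH_neg.
case: cu => hu zu _; have [||v [hv zv dv]] := kos_exact (i:=0) _ hu zu.
- by rewrite w0 orbT.
- by rewrite kdeg_kdiff0.
exists v; split=> //.
by rewrite dv subrr; apply: (zsub0 (kall_zsub vs (lin_pred_zsub hI))).
Qed.

Lemma koszulH00 (I : Q^o -> Prop) (hI : lin_pred I) u :
  (forall z, hom 0 z -> I z -> z = 0) ->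
  @cyc K (koszulH lin_pred_zhomog hI 0 0) u -> (@bnd K (koszulH lin_pred_zhomog hI 0 0) u <-> u = 0).
Proof.
move=> I0 [hu zu _]; split=> [[v [hv zv]]|->].
  have -> : v = 0 by apply/kall0; apply: kallW zv => z; apply: zhomog_neg.
  rewrite kdiff0 subr0 => iu; apply/kall0.
  by apply: (@kallW Q Q^o (fun z => hom 0 z /\ I z)); [move=> z []; apply: I0|apply/kall_and].
exists 0; split; first exact: kdeg0.
  exact: (zsub0 (kallQ_zhomog _ _)).
by rewrite kdiff0 subrr; apply: (zsub0 (kall_zsub vs (lin_pred_zsub hI))).
Qed.

Variables (IA IB : Q^o -> Prop).
Hypotheses (hA : lin_pred IA) (hB : lin_pred IB).
Hypotheses (AX : forall i z, IA z -> IA ('X_i *: z)) (BX : forall i z, IB z -> IB ('X_i *: z)).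
Hypothesis AB1 : forall z, hom 1 z -> IA z -> IB z -> z = 0.
Hypothesis ABm : forall w z, 0 < w -> hom w z -> exists2 p, hom w p & IA p /\ IB (z - p).

Definition IAB (z : Q^o) : Prop := IA z /\ IB z.
Lemma lin_pred_IAB : lin_pred IAB.
Proof.
split=> [|c u v [uA uB] [vA vB]]; first by split; [case: hA|case: hB].
by split; [case: hA => _; apply|case: hB => _; apply].
Qed.

Let sA := kall_zsub vs (lin_pred_zsub hA).
Let sB := kall_zsub vs (lin_pred_zsub hB).
Let dA (u : kQ) : kallQ IA u -> kallQ IA (kdiff u) := kall_kdiffI hA AX (u:=u).
Let dB (u : kQ) : kallQ IB u -> kallQ IB (kdiff u) := kall_kdiffI hB BX (u:=u).
Let sH i := @kdeg_zsub Q Q^o vs i.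
Let sZ w := @kallQ_zhomog K N w vs.

Local Notation HAB := (koszulH lin_pred_zhomog lin_pred_IAB).
Local Notation HA := (koszulH lin_pred_zhomog hA).
Local Notation HB := (koszulH lin_pred_zhomog hB).

Lemma split_max i w (z : kQ) : 0 < w -> kdeg i z -> kallQ (hom w) z ->
  exists p, [/\ kdeg i p, kallQ (hom w) p, kallQ IA p & kallQ IB (z - p)].
Proof.
move=> w0 hz zz.
have [||g g0 hg] := @pointed_choice Q^o Q^o (hom w) (fun z p => [/\ hom w p, IA p & IB (z - p)]).
- by move=> y /(ABm w0)[p ? [? ?]]; exists p.
- by rewrite subrr; split; [apply: zhomog0|case: hA|case: hB].
exists (kmap g z); split; first exact: kdeg_kmap.
- by apply/kall_kmap; apply: kallW zz => y /hg[].
- by apply/kall_kmap; apply: kallW zz => y /hg[].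
rewrite -[X in z - X]scale1r; apply: (kallBf _ zz) => y /hg[_ _].
by rewrite scale1r.
Qed.

(** In weight 0 the boundary of a cycle modulo the intersection has linear
coordinates in the intersection, so it vanishes. *)
Lemma HAB_low i w u : w <= 0 -> @cyc K (HAB i.+1 w) u -> @bnd K (HAB i.+1 w) u.
Proof.
rewrite le_eqVlt => /orP[/eqP->|w0]; last exact: koszulH_neg.
move=> [hu zu du]; have du0 : kdiff u = 0.
  apply/kall0; apply: (@kallW Q Q^o (fun z => hom 1 z /\ IAB z)).
    by move=> z [h [hA' hB']]; apply: AB1.
  by apply/kall_and; split=> //; have := kall_zhomog_kdiff zu; rewrite add0r.
have [|v [hv zv dv]] := kos_exact (i:=i.+1) _ hu zu du0; first by [].
exists v; split=> //.
by rewrite dv subrr; apply: (zsub0 (kall_zsub vs (lin_pred_zsub lin_pred_IAB))).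
Qed.

(** The kernel of the map from the homology modulo I \cap J to the sum of the homologies
modulo I and modulo J. *)
Definition bnd_both i w (u : kQ) : Prop := bndQ IA i w u /\ bndQ IB i w u.

Definition HAB_both i w : subquo K :=
  @Subquo K kQ (fun c u => c%:MP *: u) (cycQ IAB i w) (bnd_both i w)
    (@koszulH_cyc_lin K N _ _ _ lin_pred_zhomog lin_pred_IAB i w).

(** Surjectivity uses that u1 - u2 has positive weight, hence coordinates in I + J, for
all cycles u1 modulo I and u2 modulo J: it then splits as a difference which
corrects u1 and u2 to a common cycle. *)
Lemma HAB_both_prod i w : 0 < w -> subquo_iso (HAB_both i w) (subquo_prod (HA i w) (HB i w)).
Proof.
move=> w0; exists (fun u p => kallQ IA (u - p.1) /\ kallQ IB (u - p.2)); split=> /=.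
- move=> c u v u' v' [uA uB] [vA vB]; split.
    by rewrite opprD addrACA -scalerBr; apply: (lin_pred_kall _ hA).2.
  by rewrite opprD addrACA -scalerBr; apply: (lin_pred_kall _ hB).2.
- move=> u [hu zu /kall_and[iA iB]]; exists (u, u); first by split.
  by rewrite /= subrr; split; [apply: (zsub0 sA)|apply: (zsub0 sB)].
- move=> [u1 u2] /= [[h1 z1 i1] [h2 z2 i2]].
  have [||p [hp zp pA pB]] := @split_max i w (u1 - u2) w0.
  + exact: (zsubB (sH i)).
  + exact: (zsubB (sZ w)).
  exists (u1 - p).
    split; [exact: (zsubB (sH i))|exact: (zsubB (sZ w))|apply/kall_and; split].
      by rewrite kdiffB; apply: (zsubB sA) => //; apply: dA.
    have -> : u1 - p = u2 + (u1 - u2 - p) by rewrite addrA [u2 + _]addrC subrK.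
    by rewrite kdiffD; apply: (zsubD sB) => //; apply: dB.
  split=> /=; first by rewrite addrAC subrr add0r; apply: (zsubN sA).
  by rewrite addrAC.
move=> u [p1 p2] _ _ /= [rA rB].
have ext I (hI : lin_pred I) (x y : kQ) : kallQ I (x - y) -> bndQ I i w y -> bndQ I i w x.
  move=> xy [v [hv zv iv]]; exists v; split=> //.
  rewrite -[x](subrK y) -addrA.
  exact: (zsubD (kall_zsub vs (lin_pred_zsub hI))).
have rA' : kallQ IA (p1 - u) by rewrite -opprB; apply: (zsubN sA).
have rB' : kallQ IB (p2 - u) by rewrite -opprB; apply: (zsubN sB).
by split=> -[b1 b2]; split; [apply: (ext IA hA) rA' b1|apply: (ext IB hB) rB' b2
  |apply: (ext IA hA) rA b1|apply: (ext IB hB) rB b2].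
Qed.

Lemma bnd_bnd_both i w u : bndQ IAB i w u -> bnd_both i w u.
Proof. by move=> [v [hv zv /kall_and[iA iB]]]; split; exists v. Qed.

(** If u is the boundary of v1 modulo I and of v2 modulo J, then v1 - v2 has weight w - 1 > 0, so
its coordinates split in I + J, and v1 and v2 can be corrected to one and the
same chain. *)
Lemma bnd_both_bnd i w u : 1 < w -> bnd_both i w u -> bndQ IAB i w u.
Proof.
move=> w1 [[v1 [h1 z1 i1]] [v2 [h2 z2 i2]]].
have [|||p [hp zp pA pB]] := @split_max i.+1 (w - 1) (v1 - v2).
- by rewrite subr_gt0.
- exact: (zsubB (sH _)).
- exact: (zsubB (sZ _)).
exists (v1 - p); split; [exact: (zsubB (sH _))|exact: (zsubB (sZ _))|].
apply/kall_and; split.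
  by rewrite kdiffB opprB addrCA addrC; apply: (zsubD sA) => //; apply: dA.
have -> : v1 - p = v2 + (v1 - v2 - p) by rewrite addrA [v2 + _]addrC subrK.
by rewrite kdiffD opprD addrA; apply: (zsubB sB) => //; apply: dB.
Qed.

Lemma HAB_high i w : 1 < w -> subquo_iso (HAB i w) (subquo_prod (HA i w) (HB i w)).
Proof.
move=> w1; have w0 : 0 < w by apply: lt_trans w1.
apply: subquo_iso_trans (HAB_both_prod i w0).
by apply: subquo_iso_id => // u _; split; [apply: bnd_bnd_both|apply: bnd_both_bnd].
Qed.

Definition cyc_both i (u : kQ) := cycQ IAB i 1 u /\ bnd_both i 1 u.

Lemma koszulH_bnd_lin I (hI : lin_pred I) i w (c : K) u v :
  bndQ I i w u -> bndQ I i w v -> bndQ I i w (c%:MP *: u + v).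
Proof.
move=> [x [hx zx ix]] [y [hy zy iy]]; exists (c%:MP *: x + y); split.
- exact: kdeg_lin.
- by apply: (lin_pred_kall _ (lin_pred_zhomog _)).2.
by rewrite kdiff_lin opprD addrACA -scalerBr; apply: (lin_pred_kall _ hI).2.
Qed.

Lemma cyc_both_lin i (c : K) u v : cyc_both i u -> cyc_both i v -> cyc_both i (c%:MP *: u + v).
Proof.
move=> [cu [uA uB]] [cv [vA vB]]; split.
  by apply: (@koszulH_cyc_lin K N _ _ _ lin_pred_zhomog lin_pred_IAB).
by split; apply: koszulH_bnd_lin.
Qed.

Definition both_subquo i : subquo K :=
  @Subquo K kQ (fun c u => c%:MP *: u) (cyc_both i) (bndQ IAB i 1) (@cyc_both_lin i).

Definition conn_cyc i (e : kQ) := kdeg i e /\ kallQ (hom 0) e.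
Lemma conn_cyc_lin i (c : K) u v : conn_cyc i u -> conn_cyc i v -> conn_cyc i (c%:MP *: u + v).
Proof.
move=> [u1 u2] [v1 v2]; split; first exact: kdeg_lin.
by apply: (lin_pred_kall _ (lin_pred_zhomog _)).2.
Qed.

(** The homology of K in degree [i] and weight 0 consists of all constant chains.  Here it
is taken modulo the constant chains that are cycles modulo I or modulo J. *)
Definition conn_subquo i : subquo K :=
  @Subquo K kQ (fun c u => c%:MP *: u) (conn_cyc i)
   (fun e => exists e1 e2, [/\ conn_cyc i e1, conn_cyc i e2, kallQ IA (kdiff e1), kallQ IB (kdiff e2) & e = e1 - e2])
   (@conn_cyc_lin i).

(** The connecting homomorphism: if u is the boundary of v1 modulo I and of v2
modulo J, the class of u
corresponds to the constant chain v1 - v2. *)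
Lemma both_subquo_E i : subquo_iso (both_subquo i) (conn_subquo i.+1).
Proof.
exists (fun u e => exists v1 v2, [/\ conn_cyc i.+1 v1, conn_cyc i.+1 v2,
  kallQ IA (u - kdiff v1), kallQ IB (u - kdiff v2) & e = v1 - v2]); split=> /=.
- move=> c u v _ _ [u1 [u2 [hu1 hu2 uA uB ->]]] [v1 [v2 [hv1 hv2 vA vB ->]]].
  exists (c%:MP *: u1 + v1), (c%:MP *: u2 + v2); split; try exact: conn_cyc_lin.
  + by rewrite kdiff_lin opprD addrACA -scalerBr; apply: (lin_pred_kall _ hA).2.
  + by rewrite kdiff_lin opprD addrACA -scalerBr; apply: (lin_pred_kall _ hB).2.
  by rewrite opprD addrACA -scalerBr.
- move=> u [_ [[v1 [h1 z1 i1]] [v2 [h2 z2 i2]]]]; exists (v1 - v2).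
    by split; [apply: (zsubB (sH _))|apply: (zsubB (sZ _))].
  by exists v1, v2; split.
- move=> e [he ze].
  have zde : kallQ (hom 1) (kdiff e) by have := kall_zhomog_kdiff ze; rewrite add0r.
  (* e is reached from v1 = e and v2 = 0 *)
  have [|p [hp zp pA pB]] := @split_max i 1 (kdiff e) ltr01 _ zde; first exact: kdeg_kdiff.
  have cA : kallQ IA (kdiff e - p - kdiff e) by rewrite addrAC subrr add0r; apply: (zsubN sA).
  have z0 : conn_cyc i.+1 0 by split; [apply: kdeg0|apply: (zsub0 (sZ _))].
  exists (kdiff e - p).
    split.
      split; [by apply: (zsubB (sH _)) => //; apply: kdeg_kdiff|exact: (zsubB (sZ _))|].
      apply/kall_and; split; last exact: dB.
      by rewrite kdiffB kdiffK sub0r; apply/(zsubN sA)/dA.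
    split; first by exists e; split.
    by case: z0 => z0 z0'; exists 0; split=> //; rewrite kdiff0 subr0.
  by exists e, 0; split=> //; rewrite ?kdiff0 subr0.
move=> u _ _ _ [v1 [v2 [[h1 z1] [h2 z2] iA iB ->]]].
split=> [[v [hv zv /kall_and[vA vB]]]|[e1 [e2 [[he1 ze1] [he2 ze2] eA eB e]]]].
  have kdiffBu x : kdiff (x - v) = (u - kdiff v) - (u - kdiff x).
    by rewrite kdiffB opprB [_ + (kdiff x - u)]addrC addrA subrK.
  exists (v1 - v), (v2 - v); split.
  - by split; [apply: (zsubB (sH _))|apply: (zsubB (sZ _))].
  - by split; [apply: (zsubB (sH _))|apply: (zsubB (sZ _))].
  - by rewrite (kdiffBu v1); apply: (zsubB sA).
  - by rewrite (kdiffBu v2); apply: (zsubB sB).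
  by rewrite opprB addrA subrK.
exists (v1 - e1); split.
- exact: (zsubB (sH _)).
- exact: (zsubB (sZ _)).
apply/kall_and; split; first by rewrite kdiffB opprB addrCA addrC; apply: (zsubD sA).
have -> : v1 - e1 = v2 - e2.
  by rewrite -[v1](subrK v2) e addrAC [e1 - e2]addrC addrK addrC.
by rewrite kdiffB opprB addrCA addrC; apply: (zsubD sB).
Qed.

End MayerVietoris.

(** * The ideals of A, B and the fiber product *)

Section Resolved.
Variables (K : fieldType) (N : nat).
Local Notation Q := {mpoly K[N]}.

Lemma koszulH_ext (I I' : Q^o -> Prop) (hI : lin_pred I) (hI' : lin_pred I') i w :
  (forall z, I z <-> I' z) ->
  subquo_iso (koszulH lin_pred_zhomog hI i w) (koszulH lin_pred_zhomog hI' i w).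
Proof.
move=> h; have hk l u : @kall Q Q^o I l u <-> @kall Q Q^o I' l u.
  by split; apply: kallW => z /h.
apply: subquo_iso_id => [u|u _].
  by split=> -[h1 h2 h3]; split=> //; apply/hk.
by split=> -[v [h1 h2 h3]]; exists v; split=> //; apply/hk.
Qed.

Lemma balancing_ker (M : lmodType Q) (gr : int -> M -> Prop)
    (F : gfree_resolution gr) (e : Q -> M) (I : Q^o -> Prop) (hI : lin_pred I) :
  (forall p q, e (p - q) = e p - e q) -> (forall p q, e (p * q) = p *: e q) ->
  (forall d u, gr d u -> exists2 q, zhomog d q & u = e q) ->
  (forall q, e q = 0 <-> I q) -> (forall d q, I q -> I (zpart d q)) ->
  forall i w, subquo_iso (koszulH lin_pred_zhomog hI i w) (subquo_vs (tor F i (i%:Z + w))).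
Proof.
move=> eB eM gr_e eI Ih i w.
have ker_e d q : e q = 0 -> e (zpart d q) = 0 by move=> /eI/(Ih d)/eI.
apply: subquo_iso_trans (balancing F eB eM gr_e ker_e i w).
by apply: koszulH_ext => z; rewrite -eI.
Qed.

End Resolved.

Section FiberIdeals.
Variables (K : fieldType) (m n : nat) (a : homogIdeal K m) (b : homogIdeal K n).
Local Notation Q := {mpoly K[m + n]}.

Lemma ideal_zpart N (c : homogIdeal K N) d p :
  p \in (c : {pred _}) -> zpart d p \in (c : {pred _}).
Proof. by case: d => d /=; [apply: hideal_pihomog|rewrite rpred0]. Qed.

(** [IA] and [IB] are a + (y) and b + (x), [I0A] and [I0B] are (y) and (x), each
written as the kernel of the map from [Q]. *)
Definition IA (q : Q^o) : Prop := to_R q \in (a : {pred _}).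
Definition IB (q : Q^o) : Prop := to_S q \in (b : {pred _}).
Definition I0A (q : Q^o) : Prop := @to_R K m n q = 0.
Definition I0B (q : Q^o) : Prop := @to_S K m n q = 0.

Lemma lin_pred_IA : lin_pred IA.
Proof.
split=> [|c u v hu hv]; rewrite /IA; first by rewrite rmorph0 rpred0.
by rewrite -[_ *: u]/(c%:MP * u) rmorphD rmorphM rpredD // idealMr.
Qed.
Lemma lin_pred_IB : lin_pred IB.
Proof.
split=> [|c u v hu hv]; rewrite /IB; first by rewrite rmorph0 rpred0.
by rewrite -[_ *: u]/(c%:MP * u) rmorphD rmorphM rpredD // idealMr.
Qed.
Lemma lin_pred_I0A : lin_pred I0A.
Proof.
split=> [|c u v hu hv]; rewrite /I0A; first by rewrite rmorph0.
by rewrite -[_ *: u]/(c%:MP * u) rmorphD rmorphM /= hu hv mulr0 addr0.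
Qed.
Lemma lin_pred_I0B : lin_pred I0B.
Proof.
split=> [|c u v hu hv]; rewrite /I0B; first by rewrite rmorph0.
by rewrite -[_ *: u]/(c%:MP * u) rmorphD rmorphM /= hu hv mulr0 addr0.
Qed.

Lemma IA_X i z : IA z -> IA ('X_i *: z).
Proof. by rewrite /IA -[_ *: z]/('X_i * z) rmorphM; apply: idealMr. Qed.
Lemma IB_X i z : IB z -> IB ('X_i *: z).
Proof. by rewrite /IB -[_ *: z]/('X_i * z) rmorphM; apply: idealMr. Qed.
Lemma I0A_X i z : I0A z -> I0A ('X_i *: z).
Proof. by rewrite /I0A -[_ *: z]/('X_i * z) rmorphM /= => ->; rewrite mulr0. Qed.
Lemma I0B_X i z : I0B z -> I0B ('X_i *: z).
Proof. by rewrite /I0B -[_ *: z]/('X_i * z) rmorphM /= => ->; rewrite mulr0. Qed.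

Lemma I0A_IA z : I0A z -> IA z.
Proof. by rewrite /I0A /IA => ->; rewrite rpred0. Qed.
Lemma I0B_IB z : I0B z -> IB z.
Proof. by rewrite /I0B /IB => ->; rewrite rpred0. Qed.

(** The part of z in the y alone lies in (y), and the rest lies in (x). *)
Lemma I0_split w (z : Q) : 0 < w -> zhomog w z ->
  exists2 p, zhomog w p & I0A p /\ I0B (z - p).
Proof.
move=> w0 hz; exists (from_S m (to_S z)).
  exact/from_S_zhomog/to_S_zhomog.
split; rewrite /I0A /I0B; last by rewrite rmorphB /= from_SK subrr.
by rewrite to_R_from_S (zhomog_coef0 (to_S_zhomog hz)) // gt_eqF.
Qed.

Lemma I_split w (z : Q) : 0 < w -> zhomog w z ->
  exists2 p, zhomog w p & IA p /\ IB (z - p).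
Proof.
move=> w0 /(I0_split w0)[p hp [hA hB]]; exists p => //.
by split; [apply: I0A_IA|apply: I0B_IB].
Qed.

Lemma IA_zero (z : Q) : zhomog 0 z -> IA z -> z = 0.
Proof.
move=> /zhomog_const -> /hideal_coef0; rewrite to_R0 mcoeffC eqxx mulr1 => ->; exact: mpolyC0.
Qed.
Lemma I0A_zero (z : Q) : zhomog 0 z -> I0A z -> z = 0.
Proof. by move=> hz /I0A_IA; apply: IA_zero. Qed.
Lemma IB_zero (z : Q) : zhomog 0 z -> IB z -> z = 0.
Proof.
move=> /zhomog_const -> /hideal_coef0; rewrite to_S0 mcoeffC eqxx mulr1 => ->; exact: mpolyC0.
Qed.

Lemma I0_lin (z : Q) : zhomog 1 z -> I0A z -> I0B z -> z = 0.
Proof. exact: ker_to_RS1. Qed.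

Hypothesis ha : forall p : {mpoly K[m]}, p \in (a : {pred _}) -> p \is 1.-homog -> p = 0.
Hypothesis hb : forall p : {mpoly K[n]}, p \in (b : {pred _}) -> p \is 1.-homog -> p = 0.

Lemma IA1 (z : Q) : zhomog 1 z -> (IA z <-> I0A z).
Proof.
move=> hz; split; last exact: I0A_IA.
by move=> hA; apply: ha => //; apply: (to_R_zhomog hz).
Qed.
Lemma IB1 (z : Q) : zhomog 1 z -> (IB z <-> I0B z).
Proof.
move=> hz; split; last exact: I0B_IB.
by move=> hB; apply: hb => //; apply: (to_S_zhomog hz).
Qed.

Lemma I_lin (z : Q) : zhomog 1 z -> IA z -> IB z -> z = 0.
Proof. by move=> hz /(IA1 hz) ? /(IB1 hz); apply: I0_lin. Qed.

Lemma I0A_linear i w u : 0 < w ->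
  @cyc K (koszulH lin_pred_zhomog lin_pred_I0A i w) u -> @bnd K (koszulH lin_pred_zhomog lin_pred_I0A i w) u.
Proof.
move=> w0 [hu zu du].
have hk l (v : koszul Q^o l) : @kall Q Q^o I0A l v <-> @kall Q Q^o (var_ideal (yvars m n)) l v.
  by split; apply: kallW => z /ker_to_R.
have [|v [hv zv dv]] := kos_linear (yvars_uniq m n) w0 hu zu; first exact/hk.
by exists v; split=> //; apply/hk.
Qed.
Lemma I0B_linear i w u : 0 < w ->
  @cyc K (koszulH lin_pred_zhomog lin_pred_I0B i w) u -> @bnd K (koszulH lin_pred_zhomog lin_pred_I0B i w) u.
Proof.
move=> w0 [hu zu du].
have hk l (v : koszul Q^o l) : @kall Q Q^o I0B l v <-> @kall Q Q^o (var_ideal (xvars m n)) l v.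
  by split; apply: kallW => z /ker_to_S.
have [|v [hv zv dv]] := kos_linear (xvars_uniq m n) w0 hu zu; first exact/hk.
by exists v; split=> //; apply/hk.
Qed.

(** The boundary of a constant chain has linear coordinates, and a, b contain no
linear forms. *)
Lemma conn_subquo_IA i : subquo_iso (conn_subquo IA IB i) (conn_subquo I0A I0B i).
Proof.
have h1 (I I' : Q^o -> Prop) (e : koszul Q^o (vars K (m + n))) :
    (forall z : Q, zhomog 1 z -> I z -> I' z) ->
    conn_cyc i e -> @kall Q Q^o I _ (kdiff e) -> @kall Q Q^o I' _ (kdiff e).
  move=> h [_ ze] ie; apply: (@kallW Q Q^o (fun z => zhomog 1 z /\ I z)).
    by move=> z []; apply: h.
  by apply/kall_and; split=> //; have := kall_zhomog_kdiff ze; rewrite add0r.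
apply: subquo_iso_id => // u _; split=> -[e1 [e2 [c1 c2 i1 i2 e]]]; exists e1, e2; split=> //.
- by apply: h1 c1 i1 => z hz /(IA1 hz).
- by apply: h1 c2 i2 => z hz /(IB1 hz).
- by apply: h1 c1 i1 => z hz /(IA1 hz).
- by apply: h1 c2 i2 => z hz /(IB1 hz).
Qed.

End FiberIdeals.

(** * Tor of the fiber product *)

Local Open Scope quotient_scope.

Section FiberTor.
Variables (K : fieldType) (m n : nat) (a : homogIdeal K m) (b : homogIdeal K n).
Local Notation Q := {mpoly K[m + n]}.
Variables (FA : gfree_resolution (@degA K m n a)) (FB : gfree_resolution (@degB K m n b)).
Variables (Fxy : gfree_resolution (@degXY K m n)).
Variable (FAB : gfree_resolution (@deg_fprod K m n a b)).

Lemma galg_pi0 N (c : homogIdeal K N) p : galg_pi c p = 0 <-> p \in (c : {pred _}).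
Proof.
have := galg_pi_eq c p 0; rewrite subr0 rmorph0 => <-.
by split=> [->|/eqP].
Qed.

Definition eA (q : Q) : modA n a := galg_pi a (to_R q).
Definition eB (q : Q) : modB m b := galg_pi b (to_S q).
Definition eXY (q : Q) : modXY K m n := \pi_(Quotient.quot (@ideal_xy K m n)) q.

Lemma eA_eB (q : Q) : (eA q, eB q) \in fprod_pred (a := a) (b := b).
Proof.
rewrite [_ \in _]/in_mem /= /fprod_pred /=; apply/eqP.
by rewrite [LHS]galg_augE [RHS]galg_augE to_R0 to_S0.
Qed.
Definition eAB (q : Q) : fprod a b := Fprod (eA_eB q).

Lemma iso_A i w : subquo_iso (koszulH lin_pred_zhomog (@lin_pred_IA K m n a) i w) (subquo_vs (tor FA i (i%:Z + w))).
Proof.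
apply: (balancing_ker FA (e := eA)) => [p q|p q|d u [p hp ->]|q|d q].
- by rewrite /eA !rmorphB.
- by rewrite /eA !rmorphM.
- exists (from_R n p); first exact: from_R_zhomog.
  by rewrite /eA from_RK.
- exact: galg_pi0.
by rewrite /IA to_R_zpart; apply: ideal_zpart.
Qed.

Lemma iso_B i w : subquo_iso (koszulH lin_pred_zhomog (@lin_pred_IB K m n b) i w) (subquo_vs (tor FB i (i%:Z + w))).
Proof.
apply: (balancing_ker FB (e := eB)) => [p q|p q|d u [p hp ->]|q|d q].
- by rewrite /eB !rmorphB.
- by rewrite /eB !rmorphM.
- exists (from_S m p); first exact: from_S_zhomog.
  by rewrite /eB from_SK.
- exact: galg_pi0.
by rewrite /IB to_S_zpart; apply: ideal_zpart.
Qed.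

Let hIAB := lin_pred_IAB (@lin_pred_IA K m n a) (@lin_pred_IB K m n b).
Let hI0 := lin_pred_IAB (@lin_pred_I0A K m n) (@lin_pred_I0B K m n).

Lemma iso_XY i w : subquo_iso (koszulH lin_pred_zhomog hI0 i w) (subquo_vs (tor Fxy i (i%:Z + w))).
Proof.
apply: (balancing_ker Fxy (e := eXY)) => [p q|p q|d u [p hp ->]|q|d q].
- by rewrite /eXY !rmorphB.
- by rewrite /eXY !rmorphM.
- by exists p.
- have := Quotient.idealrBE (@ideal_xy K m n) q 0; rewrite subr0 rmorph0 => e.
  by rewrite /IAB -ideal_xyP e; split=> [h|/eqP]; first exact/eqP.
by move=> [hA hB]; split; rewrite /I0A /I0B ?to_R_zpart ?to_S_zpart ?hA ?hB zpart0.
Qed.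

(** A homogeneous element (p, q) of the fiber product is the image of
p + q - c, where c is the common constant term of p and q. *)
Lemma iso_AB i w : subquo_iso (koszulH lin_pred_zhomog hIAB i w) (subquo_vs (tor FAB i (i%:Z + w))).
Proof.
apply: (balancing_ker FAB (e := eAB)) => [p q|p q|d u|q|d q].
- by apply: val_inj => /=; congr (_, _); rewrite /eA /eB !rmorphB.
- by apply: val_inj => /=; congr (_, _); rewrite /eA /eB !rmorphM.
- move=> [[p hp eu] [q hq ev]].
  have e0 : p@_0%MM = q@_0%MM.
    case: u eu ev => -[u v] /= uv eu ev; move: uv.
    rewrite [_ \in _]/in_mem /= /fprod_pred /= eu ev.
    by move=> /eqP h; exact: etrans (esym (galg_augE a p)) (etrans h (galg_augE b q)).
  exists (from_R n p + from_S m q - (q@_0%MM)%:MP).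
    apply: (zsubB (zhomog_zsub _)).
      by apply: (zsubD (zhomog_zsub _)); [apply: from_R_zhomog|apply: from_S_zhomog].
    by apply: zhomogC; apply: zhomog_coef0.
  apply: val_inj; case: u eu ev => -[u v] /= _ -> ->; congr (_, _).
    rewrite /eA !(rmorphB, rmorphD) /= from_RK to_R_from_S.
    by rewrite [@to_R K m n _]comp_mpolyC addrK.
  rewrite /eB !(rmorphB, rmorphD) /= from_SK to_S_from_R e0.
  by rewrite [@to_S K m n _]comp_mpolyC addrC addKr.
- split=> [/(congr1 val) [hA hB]|[hA hB]].
    by split; apply/galg_pi0.
  by apply: val_inj => /=; congr (_, _); apply/galg_pi0.
move=> [hA hB]; split; first by rewrite /IA to_R_zpart; apply: ideal_zpart.
by rewrite /IB to_S_zpart; apply: ideal_zpart.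
Qed.

Hypothesis ha : forall p : {mpoly K[m]}, p \in (a : {pred _}) -> p \is 1.-homog -> p = 0.
Hypothesis hb : forall p : {mpoly K[n]}, p \in (b : {pred _}) -> p \is 1.-homog -> p = 0.

Lemma tor_low i w : w <= 0 -> forall v : tor FAB i.+1 (i.+1%:Z + w), v = 0.
Proof.
move=> w0; apply/(subquo_iso_zero (iso_AB _ _)) => u.
by apply: HAB_low => // z; apply: I_lin.
Qed.

Lemma tor_xy_low i w : w <= 0 -> forall v : tor Fxy i.+1 (i.+1%:Z + w), v = 0.
Proof.
move=> w0; apply/(subquo_iso_zero (iso_XY _ _)) => u.
by apply: HAB_low => // z; apply: I0_lin.
Qed.

Lemma tor_high i w : 1 < w ->
  vs_iso (tor FAB i (i%:Z + w)) (tor FA i (i%:Z + w) * tor FB i (i%:Z + w))%type.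
Proof.
move=> w1; apply/subquo_iso_vs/(subquo_iso_trans (subquo_iso_sym (iso_AB _ _))).
have h := HAB_high (@lin_pred_IA K m n a) (@lin_pred_IB K m n b) (@IA_X K m n a) (@IB_X K m n b) (@I_split K m n a b) i w1.
apply: (subquo_iso_trans h).
exact: (subquo_iso_trans (subquo_iso_prod (iso_A _ _) (iso_B _ _)) (subquo_iso_prodV _ _)).
Qed.

Lemma tor_xy_high i w : 1 < w -> forall v : tor Fxy i (i%:Z + w), v = 0.
Proof.
move=> w1; apply/(subquo_iso_zero (iso_XY _ _)) => u cu.
have w0 : 0 < w by apply: lt_trans w1.
apply: (bnd_both_bnd (@lin_pred_I0A K m n) (@lin_pred_I0B K m n) (@I0A_X K m n) (@I0B_X K m n) (@I0_split K m n) w1); case: cu => hu zu /kall_and[iA iB].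
by split; [apply: I0A_linear|apply: I0B_linear].
Qed.

(** The homology of the fiber product in weight 1 is an extension of that of A and B by
the kernel [both_subquo], which is the homology of Q / (x \cap y). *)
Lemma betti_strand i : betti FAB i (i%:Z + 1) =
  (betti FA i (i%:Z + 1) + betti FB i (i%:Z + 1) + betti Fxy i (i%:Z + 1))%N.
Proof.
pose hZ := @koszulH_cyc_lin K (m + n) _ _ _ lin_pred_zhomog hIAB i 1.
have -> : betti FAB i (i%:Z + 1) =
    (\dim {: (tor FA i (i%:Z + 1) * tor FB i (i%:Z + 1))%type} + betti Fxy i (i%:Z + 1))%N.
  apply: (subquo_dim_ext (hZ := hZ) (hW := cyc_both_lin (@lin_pred_IA K m n a) (@lin_pred_IB K m n b) (i:=i))
     (B := koszulH_bnd (M := Q^o) (@zhomog K (m + n)) (IAB (IA a) (IB b)) i 1)).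
  - by move=> u [].
  - by move=> u cu bu; split=> //; apply: bnd_bnd_both.
  - exact: iso_AB.
  - apply: (subquo_iso_trans _ (subquo_iso_trans (HAB_both_prod (@lin_pred_IA K m n a) (@lin_pred_IB K m n b) (@IA_X K m n a) (@IB_X K m n b) (@I_split K m n a b) i ltr01) _)).
      by apply: subquo_iso_id => // u cu; split=> [[]|].
    exact: (subquo_iso_trans (subquo_iso_prod (iso_A _ _) (iso_B _ _)) (subquo_iso_prodV _ _)).
  apply: (subquo_iso_trans _ (iso_XY _ _)).
  apply: (subquo_iso_trans (both_subquo_E (@lin_pred_IA K m n a) (@lin_pred_IB K m n b) (@IA_X K m n a) (@IB_X K m n b) (@I_split K m n a b) i)).
  apply: (subquo_iso_trans (conn_subquo_IA ha hb i.+1)).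
  apply: subquo_iso_trans (subquo_iso_sym (both_subquo_E (@lin_pred_I0A K m n) (@lin_pred_I0B K m n) (@I0A_X K m n) (@I0B_X K m n) (@I0_split K m n) i)) _.
  apply: subquo_iso_id => // u; split=> [[]//|cu]; split=> //.
  case: cu => hu zu /kall_and[iA iB].
  by split; [apply: I0A_linear|apply: I0B_linear].
by congr (_ + _)%N; rewrite /betti !dimvf.
Qed.

End FiberTor.

(** * Betti numbers of cyclic modules and existence of the regularity *)

Section CyclicResolution.
Variables (K : fieldType) (N : nat) (M : lmodType {mpoly K[N]}) (gr : int -> M -> Prop).
Variables (F : gfree_resolution gr) (I : {mpoly K[N]}^o -> Prop) (hI : lin_pred I).
Hypothesis iso : forall i w, subquo_iso (koszulH lin_pred_zhomog hI i w) (subquo_vs (tor F i (i%:Z + w))).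
Hypothesis I_zero : forall z : {mpoly K[N]}, zhomog 0 z -> I z -> z = 0.

Lemma betti_eq0 i w :
  (forall u, @cyc K (koszulH lin_pred_zhomog hI i w) u -> @bnd K (koszulH lin_pred_zhomog hI i w) u) <->
  betti F i (i%:Z + w) = 0%N.
Proof. by rewrite -(subquo_iso_zero (iso i w)); apply: dim_zero. Qed.

Lemma split_deg (i : nat) (j : int) : j = i%:Z + (j - i%:Z).
Proof. by rewrite addrC subrK. Qed.

Lemma betti_neg i j : j < i%:Z -> betti F i j = 0%N.
Proof.
move=> ji; rewrite (split_deg i j); apply/betti_eq0 => u; apply: koszulH_neg.
by rewrite subr_lt0.
Qed.

Lemma betti_big i j : (N < i)%N -> betti F i j = 0%N.
Proof. by move=> Ni; rewrite (split_deg i j); apply/betti_eq0 => u; apply: koszulH_big. Qed.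

Lemma betti0 j : j != 0 -> betti F 0 j = 0%N.
Proof. by move=> j0; rewrite -[j]add0r; apply/betti_eq0 => u; apply: koszulH_zero. Qed.

Lemma betti00 : betti F 0 0 <> 0%N.
Proof.
move/(betti_eq0 0 0) => h; have h1 : zhomog 0 (1 : {mpoly K[N]}) := dhomog1 _ _.
pose u := kin (vars K N) (1 : {mpoly K[N]}^o).
have cu : @cyc K (koszulH lin_pred_zhomog hI 0 0) u.
  split; first exact: kdeg_kin.
    by apply: kall_kin => //; apply: zhomog0.
  rewrite kdeg_kdiff0; last exact: kdeg_kin.
  exact: (zsub0 (kall_zsub _ (lin_pred_zsub hI))).
have /(koszulH00 I_zero cu) u0 := h u cu.
have /eqP : (1 : {mpoly K[N]}^o) = 0.
  by apply: (@kin_inj _ _ (vars K N)); apply: etrans u0 (esym (kin0 _ _)).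
by rewrite oner_eq0.
Qed.

(** Tor is a subquotient of F_i (x) K, so it lives in the degrees of the basis of F_i. *)
Lemma betti_deg i j : betti F i j <> 0%N -> exists k : 'I_(fr_rank F i), fr_deg k = j.
Proof.
apply: contra_notP => h; apply/dim_zero/(subquo_iso_zero (tor_subquo_tor F i j)) => v /= cv.
suff -> : v = 0 by apply: mem0v.
have : v \in tens_deg F i j.
  by case: i h v cv => [|i] h v //=; rewrite memv_cap => /andP[].
move/tens_degP => kv; apply/rowP => k; rewrite mxE kv //.
by apply/eqP => kj; apply: h; exists k.
Qed.

(** Nonzero Betti numbers occur only for i <= N and, for each such i, only in the
finitely many degrees of a basis of F_i. *)
Lemma reg_exists : exists r, is_reg F r.
Proof.
pose P (r : nat) := `[< exists i j, betti F i j <> 0%N /\ j - i%:Z = r%:Z >].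
have P0 : exists r, P r.
  by exists 0%N; apply/asboolP; exists 0%N, 0; split; first exact: betti00.
(* an upper bound for the degrees of the basis vectors of all F_i with i <= N *)
pose B := (\sum_(i < N.+1) \sum_(k < fr_rank F i) `|fr_deg k|)%N.
have PB r : P r -> (r <= B)%N.
  move=> /asboolP[i [j [bij e]]].
  have iN : (i < N.+1)%N by rewrite ltnNge; apply/negP => h; apply: bij; apply: betti_big.
  have [k dk] := betti_deg bij.
  have h1 : (`|j| <= \sum_(k < fr_rank F i) `|fr_deg k|)%N.
    by rewrite (bigD1 k) //= dk leq_addr.
  have h2 : (\sum_(k < fr_rank F i) `|fr_deg k| <= B)%N.
    by rewrite /B (bigD1 (Ordinal iN)) //= leq_addr.
  lia.
case: (ex_maxnP P0 PB) => r /asboolP[i [j [bij e]]] rmax.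
exists r%:Z; split; first by exists i, j.
move=> i' j' b'; have ge0 : 0 <= j' - i'%:Z.
  by rewrite subr_ge0 leNgt; apply/negP => /betti_neg.
have := rmax `|j' - i'%:Z|%N; rewrite -lez_nat gez0_abs //; apply.
by apply/asboolP; exists i', j'; rewrite gez0_abs.
Qed.

Lemma reg_ge0 r : is_reg F r -> 0 <= r.
Proof. by move=> [_ h]; have := h 0%N 0 betti00; rewrite subr0. Qed.

End CyclicResolution.

(** * Regularity of the fiber product *)

Section Generators.
Variables (K : fieldType) (N N' : nat) (c : homogIdeal K N').
Variables (t : {rmorphism {mpoly K[N]} -> {mpoly K[N']}}) (s : {mpoly K[N']} -> {mpoly K[N]}).
Variables (I : {mpoly K[N]}^o -> Prop) (hI : lin_pred I).
Hypothesis IE : forall q, I q <-> t q \in (c : {pred _}).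
Hypothesis t_hom : forall d q, zhomog d q -> zhomog d (t q).
Hypothesis s_hom : forall d p, zhomog d p -> zhomog d (s p).
Hypothesis sK : cancel s t.
Hypothesis hc : forall p : {mpoly K[N']}, p \in (c : {pred _}) -> p \is 1.-homog -> p = 0.

(** Let p be a nonzero element of least degree d of the ideal; d >= 2.  Write p = du with u
of degree 1 and weight d - 1, a cycle modulo I.  If u were dv modulo I then p would be
the boundary of u - dv, whose coordinates lie in I in degree d - 1; these map
to 0 by minimality of d, and so does p. *)
Lemma generator_degree : (exists2 p, p \in (c : {pred _}) & p != 0) ->
  exists2 w, 0 < w & ~ (forall u,
    @cyc K (koszulH lin_pred_zhomog hI 1 w) u -> @bnd K (koszulH lin_pred_zhomog hI 1 w) u).
Proof.
move=> [p0 p0c p0n].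
pose P (d : nat) := `[< exists p, [/\ p \in (c : {pred _}), p \is d.-homog & p != 0] >].
have exP : exists d, P d.
  apply: contrapT => h; move/eqP: p0n; apply.
  rewrite (pihomog_partitionE (leqnn (msize p0))); apply: big1 => d _.
  apply/eqP/negPn/negP => nz; apply: h; exists (d : nat).
  by apply/asboolP; exists (pihomog mdeg d p0); split; [apply: hideal_pihomog|apply: pihomogP|].
case: (ex_minnP exP) => d /asboolP[p [pc pd pn]] dmin.
have d_gt1 : (1 < d)%N.
  case: d pd {dmin} => [|[|d]] // pd; last by move: pn; rewrite (hc pc pd) eqxx.
  by move: pn; rewrite (@zhomog_const K N' p pd) (hideal_coef0 pc) mpolyC0 eqxx.
exists (d%:Z - 1) => [|h]; first by lia.
have hp : zhomog d%:Z (s p) by apply: s_hom.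
have p00 : (s p)@_0%MM = 0 by apply: zhomog_coef0 hp _; lia.
have lp : lspan (M := {mpoly K[N]}^o) (@zhomog K N) (vars K N) d%:Z (s p).
  by apply/lspan_var_ideal; split=> //; apply: var_ideal_all.
have [u [hu zu du]] := (lspan_kdiff (M := {mpoly K[N]}^o) zhomog_zsub _ _ _).1 lp.
have [|v [hv zv iv]] := h u.
  split=> //; rewrite du; apply: kall_kin; first by case: hI.
  by apply/IE; rewrite sK.
have ker0 : zsub (fun z : {mpoly K[N]}^o => t z = 0).
  by split=> [|x y /= tx ty]; rewrite ?rmorph0 // rmorphB tx ty subrr.
have tk : @kall {mpoly K[N]} {mpoly K[N]}^o (fun z => t z = 0) _ (u - kdiff v).
  apply: (@kallW {mpoly K[N]} {mpoly K[N]}^o (fun z => zhomog (d%:Z - 1) z /\ I z)).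
    move=> z [hz /IE tz]; apply/eqP/negPn/negP => tn.
    have /dmin : P d.-1.
      apply/asboolP; exists (t z); split=> //; have := t_hom hz.
      by have -> : d%:Z - 1 = d.-1%:Z by lia.
    by lia.
  apply/kall_and; split=> //; apply: (zsubB (kallQ_zhomog _ _)) => //.
  by have := kall_zhomog_kdiff zv; rewrite subrK.
have /kall_kinP : @kall {mpoly K[N]} {mpoly K[N]}^o (fun z => t z = 0) _ (kin (M := {mpoly K[N]}^o) (vars K N) (s p)).
  rewrite -du -[kdiff u]subr0 -(kdiffK v) -kdiffB; apply: (kall_kdiff ker0 _ tk).
  by move=> x _ z tz; rewrite -[_ *: z]/(x * z) rmorphM tz mulr0.
by rewrite rmorph0 sK => /(_ erefl) p0'; rewrite p0' eqxx in pn.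
Qed.

End Generators.

Section Regularity.
Variables (K : fieldType) (m n : nat) (a : homogIdeal K m) (b : homogIdeal K n).
Local Notation Q := {mpoly K[m + n]}.
Variables (FA : gfree_resolution (@degA K m n a)) (FB : gfree_resolution (@degB K m n b)).
Variables (Fxy : gfree_resolution (@degXY K m n)).
Variable (FAB : gfree_resolution (@deg_fprod K m n a b)).
Hypothesis ha : forall p : {mpoly K[m]}, p \in (a : {pred _}) -> p \is 1.-homog -> p = 0.
Hypothesis hb : forall p : {mpoly K[n]}, p \in (b : {pred _}) -> p \is 1.-homog -> p = 0.

Let zAB (z : Q) : zhomog 0 z -> IAB (IA a) (IB b) z -> z = 0.
Proof. by move=> hz [/(IA_zero hz)]. Qed.
Let zXY (z : Q) : zhomog 0 z -> IAB (@I0A K m n) (@I0B K m n) z -> z = 0.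
Proof. by move=> hz [/(I0A_zero a hz)]. Qed.

(** Neither kernel contains a nonzero constant, so both groups are K. *)
Lemma betti_AB0 j : betti FAB 0 j = betti Fxy 0 j.
Proof.
have [->|j0] := eqVneq j 0; last by rewrite (betti0 (iso_AB FAB)) // (betti0 (iso_XY Fxy)).
apply: subquo_iso_dim; apply: subquo_iso_trans (subquo_iso_sym (iso_AB FAB 0 0)) _.
apply: subquo_iso_trans (iso_XY Fxy 0 0).
have cE u : @cyc K (koszulH lin_pred_zhomog (lin_pred_IAB (@lin_pred_IA K m n a) (@lin_pred_IB K m n b)) 0 0) u <->
    @cyc K (koszulH lin_pred_zhomog (lin_pred_IAB (@lin_pred_I0A K m n) (@lin_pred_I0B K m n)) 0 0) u.
  split=> -[hu zu _]; split=> //; rewrite kdeg_kdiff0 //.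
    exact: (zsub0 (kall_zsub _ (lin_pred_zsub (lin_pred_IAB (@lin_pred_I0A K m n) (@lin_pred_I0B K m n))))).
  exact: (zsub0 (kall_zsub _ (lin_pred_zsub (lin_pred_IAB (@lin_pred_IA K m n a) (@lin_pred_IB K m n b))))).
apply: subquo_iso_id => [|u cu]; first exact: cE.
have h1 := koszulH00 (hI := lin_pred_IAB (@lin_pred_IA K m n a) (@lin_pred_IB K m n b)) zAB cu.
exact: iff_trans h1 (iff_sym (koszulH00 zXY ((cE u).1 cu))).
Qed.

Lemma betti_xy_eq0 i j : betti Fxy i j <> 0%N -> i = 0%N \/ j = i%:Z + 1.
Proof.
case: i => [|i]; first by left.
rewrite (split_deg i.+1 j); move: (j - _) => w bn; right; congr (_ + _).
apply/eqP; rewrite eq_le; apply/andP; split; rewrite leNgt; apply/negP => hw; apply: bn.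
  by apply/dim_zero; apply: tor_xy_high.
by apply/dim_zero; apply: tor_xy_low; lia.
Qed.

Lemma poincare_AB i j : poincare FAB i j =
  (poincare_above FA i j + poincare_above FB i j + poincare Fxy i j)%N.
Proof.
rewrite /poincare /poincare_above; case: i => [|i].
  rewrite betti_AB0; case: ifP => // j0.
  by rewrite (betti0 (iso_A FA)) ?(betti0 (iso_B FB)) // gt_eqF.
rewrite (split_deg i.+1 j); move: (j - _) => w; rewrite ltrDl.
case: (ltrgtP w 1) => [w1|w1|->]; last by rewrite ltr01 (betti_strand FA FB Fxy FAB ha hb).
  have w0 : w <= 0 by lia.
  rewrite ltNge w0 /= !add0n.
  have -> : betti FAB i.+1 (i.+1%:Z + w) = 0%N by apply/dim_zero/tor_low.
  by apply/esym/dim_zero/tor_xy_low.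
have -> : 0 < w by apply: lt_trans w1.
have -> : betti Fxy i.+1 (i.+1%:Z + w) = 0%N by apply/dim_zero/tor_xy_high.
by rewrite addn0 /betti (vs_iso_dim (tor_high FA FB FAB i.+1 w1)) !dimvf.
Qed.

(** If there are no x or no y the ideal x \cap y is zero. *)
Lemma xy_mn0 i : m = 0%N \/ n = 0%N -> betti Fxy i.+1 (i.+1%:Z + 1) = 0%N.
Proof.
move=> mn; apply/dim_zero/(subquo_iso_zero (iso_XY _ _ _)) => u [hu zu /kall_and[iA iB]].
have du : kdiff u = 0.
  case: mn => h; apply/kall0.
    apply: kallW iB => z /ker_to_S hz; apply/var_ideal_nil; apply: var_idealW hz => i'.
    by move=> /mapP[[k hk] _ _]; exfalso; move: hk; rewrite h.
  apply: kallW iA => z /ker_to_R hz; apply/var_ideal_nil; apply: var_idealW hz => i'.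
  by move=> /mapP[[k hk] _ _]; exfalso; move: hk; rewrite h.
have [|v [hv zv dv]] := kos_exact (i:=i.+1) _ hu zu du; first by [].
exists v; split=> //; rewrite dv subrr.
exact: (zsub0 (kall_zsub _ (lin_pred_zsub (lin_pred_IAB (@lin_pred_I0A K m n) (@lin_pred_I0B K m n))))).
Qed.

Lemma reg_A_ge1 rA : (exists2 p : {mpoly K[m]}, p \in (a : {pred _}) & p != 0) ->
  is_reg FA rA -> 1 <= rA.
Proof.
move=> pa [_ rmax].
have [w w0 h] := generator_degree (t := @to_R K m n) (s := @from_R K m n) (I := IA a)
  (@lin_pred_IA K m n a) (fun q => iff_refl _) (@to_R_zhomog K m n) (@from_R_zhomog K m n)
  (@from_RK K m n) ha pa.
have : betti FA 1 (1%N%:Z + w) <> 0%N by move/(betti_eq0 (iso_A FA)).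
by move/rmax; lia.
Qed.

Lemma reg_B_ge1 rB : (exists2 p : {mpoly K[n]}, p \in (b : {pred _}) & p != 0) ->
  is_reg FB rB -> 1 <= rB.
Proof.
move=> pb [_ rmax].
have [w w0 h] := generator_degree (t := @to_S K m n) (s := @from_S K m n) (I := IB b)
  (@lin_pred_IB K m n b) (fun q => iff_refl _) (@to_S_zhomog K m n) (@from_S_zhomog K m n)
  (@from_SK K m n) hb pb.
have : betti FB 1 (1%N%:Z + w) <> 0%N by move/(betti_eq0 (iso_B FB)).
by move/rmax; lia.
Qed.

Lemma reg_AB rA rB :
  [\/ exists2 p : {mpoly K[m]}, p \in (a : {pred _}) & p != 0,
      exists2 p : {mpoly K[n]}, p \in (b : {pred _}) & p != 0,
      m = 0%N | n = 0%N] ->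
  is_reg FA rA -> is_reg FB rB -> is_reg FAB (Num.max rA rB).
Proof.
move=> nondeg regA regB.
have rA0 := reg_ge0 (iso_A FA) (@IA_zero K m n a) regA.
have rB0 := reg_ge0 (iso_B FB) (@IB_zero K m n b) regB.
have AB i j : i%:Z < j ->
    betti FAB i j = (betti FA i j + betti FB i j + betti Fxy i j)%N.
  by move=> ij; have := poincare_AB i j; rewrite /poincare /poincare_above ij.
split.
  have top r : (exists i j, (betti FA i j <> 0 \/ betti FB i j <> 0)%N /\ j - i%:Z = r) ->
      0 <= r -> exists i j, betti FAB i j <> 0%N /\ j - i%:Z = r.
    move=> [i [j [bn e]]]; rewrite le_eqVlt => /orP[/eqP r0|r0].
      exists 0%N, 0; rewrite -r0; split=> //.
      exact: (betti00 (iso_AB FAB) zAB).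
    by exists i, j; split=> //; rewrite AB; lia.
  have [[iA [jA [bA eA]]] _] := regA; have [[iB [jB [bB eB]]] _] := regB.
  case: (leP rA rB) => _; apply: top => //.
    by exists iB, jB; split=> //; right.
  by exists iA, jA; split=> //; left.
move=> i j bn; rewrite le_max.
have [ij|ij] := leP j i%:Z; first by apply/orP; left; lia.
rewrite AB // in bn.
have [bA|/eqP/regA.2 ->//] := eqVneq (betti FA i j) 0%N.
have [bB|/eqP/regB.2 ->] := eqVneq (betti FB i j) 0%N; last exact: orbT.
rewrite bA bB in bn.
have ge1 : (1 <= rA) || (1 <= rB).
  case: nondeg => [pa|pb|m0|n0].
  - by rewrite (reg_A_ge1 pa regA).
  - by rewrite (reg_B_ge1 pb regB) orbT.
  - case: bn; case: i ij {bA bB} => [|i] ij.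
      by rewrite (betti0 (iso_XY Fxy)) // gt_eqF.
    have [->//|bn] := eqVneq (betti Fxy i.+1 j) 0%N.
    by have [//|->] := betti_xy_eq0 (elimN eqP bn); rewrite xy_mn0 //; left.
  - case: bn; case: i ij {bA bB} => [|i] ij.
      by rewrite (betti0 (iso_XY Fxy)) // gt_eqF.
    have [->//|bn] := eqVneq (betti Fxy i.+1 j) 0%N.
    by have [//|->] := betti_xy_eq0 (elimN eqP bn); rewrite xy_mn0 //; right.
have [i0|->] := betti_xy_eq0 bn.
  by rewrite i0 in bn ij; case: bn; rewrite (betti0 (iso_XY Fxy)) // gt_eqF.
by rewrite addrC addKr.
Qed.

End Regularity.

(* In the last part, the case a = b = 0 with m, n >= 1 is excluded: there
   reg A = reg B = 0, whereas A x_K B = Q / (x \cap y) has regularity 1. *)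
Theorem theorem3p2 (K : fieldType) (m n : nat)
  (a : homogIdeal K m) (b : homogIdeal K n)
  (ha : forall p : {mpoly K[m]}, p \in (a : {pred _}) -> p \is 1.-homog -> p = 0)
  (hb : forall p : {mpoly K[n]}, p \in (b : {pred _}) -> p \is 1.-homog -> p = 0)
  (FA : gfree_resolution (@degA K m n a))
  (FB : gfree_resolution (@degB K m n b))
  (Fxy : gfree_resolution (@degXY K m n))
  (FAB : gfree_resolution (@deg_fprod K m n a b)) :
  (forall (i : nat) (j : int), (1 <= i)%N ->
     [/\ j <= i%:Z -> forall v : tor FAB i j, v = 0,
         j = i%:Z + 1 ->
           vs_iso (tor FAB i j)
             (tor FA i (i%:Z + 1) * tor FB i (i%:Z + 1) * tor Fxy i (i%:Z + 1))%type
       & i%:Z + 2 <= j ->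
           vs_iso (tor FAB i j) (tor FA i j * tor FB i j)%type])
  /\ (forall (i : nat) (j : int),
        poincare FAB i j
        = (poincare_above FA i j + poincare_above FB i j + poincare Fxy i j)%N)
  /\ ([\/ exists2 p : {mpoly K[m]}, p \in (a : {pred _}) & p != 0,
          exists2 p : {mpoly K[n]}, p \in (b : {pred _}) & p != 0,
          m = 0%N | n = 0%N] ->
      exists rA rB : int,
        [/\ is_reg FA rA, is_reg FB rB & is_reg FAB (Num.max rA rB)]).
Proof.
split=> [i j i1|].
  rewrite (split_deg i j); move: (j - _) => w; split=> h.
  - by case: i i1 h => // i _ h; apply: tor_low => //; lia.
  - have -> : w = 1 by apply: (addrI i%:Z).
    apply: dim_vs_iso; have := betti_strand FA FB Fxy FAB ha hb i.
    by rewrite /betti => ->; rewrite !dimvf.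
  by apply: tor_high; lia.
split=> [i j|nondeg]; first exact: poincare_AB.
have [rA regA] := reg_exists (iso_A FA) (@IA_zero K m n a).
have [rB regB] := reg_exists (iso_B FB) (@IB_zero K m n b).
exists rA, rB; split; [exact: regA|exact: regB|exact: (reg_AB Fxy FAB ha hb nondeg regA regB)].
Qed.
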